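(* Consider the adaptive system $$\dot x=A_px+bu,\qquad \dot x_m=A_mx_m+br+\ell(x-x_m),$$ $$u=\theta^Tx+r,\qquad \dot\theta=\mathrm{Proj}_\Gamma\left(\theta,-xe^TPb,f\right),\qquad e=x-x_m,$$ with all objects as in the context (in particular the matching condition $A_m=A_p+b\theta^{*T}$ and $\|\theta^*\|\le\theta^*_{max}$ hold), and with $\|\theta(0)\|\le\theta_{\max}$. Let $\rho=\gamma/(\sigma+\ell)$ and $\tilde\theta=\theta-\theta^*$. Then there are constants $\kappa_1,\kappa_2>0$, independent of $\rho$ and $\ell$, such that for all $t\ge0$ $$\|e(t)\|^2\le\kappa_1\|e(0)\|^2\exp\left(-\frac{\sigma+2\ell}{m^2}t\right)+\frac{\kappa_2}{\rho}\tilde\theta_{\max}^2,$$ and moreover $$\int_0^\infty\|e(t)\|^2\,dt\le\frac1{\sigma+\ell}\left(m^2\|e(0)\|^2+\frac1\rho\|\tilde\theta(0)\|^2\right).$$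
   Context: $\|\cdot\|$ is the Euclidean norm (induced norm for matrices). $A_p\in\mathbb R^{n\times n}$, $b\in\mathbb R^n$, $A_m\in\mathbb R^{n\times n}$ is Hurwitz, $r:[0,\infty)\to\mathbb R$ is bounded, $\ell\ge0$, $\gamma>0$, $\Gamma=\gamma I_{n\times n}$. $\theta^*\in\mathbb R^n$ satisfies $A_m=A_p+b\theta^{*T}$ and $\|\theta^*\|\le\theta^*_{max}$, with $\theta^*_{max}>0$ known. $\bar A_m=A_m-\ell I_{n\times n}$ and $P=P^T>0$ solves $\bar A_m^TP+P\bar A_m=-I_{n\times n}$. Constants: $\sigma=-\max_i\mathrm{Re}\,\lambda_i(A_m)$, $s=-\min_i\lambda_i\big((A_m+A_m^T)/2\big)$, $a=\|A_m\|$, $m=(1+4a/\sigma)^{n-1}$. Projection: with $\vartheta=\theta^*_{max}$ and a design constant $\varepsilon>0$, $f(\theta)=\dfrac{\|\theta\|^2-\vartheta^2}{2\varepsilon\vartheta+\varepsilon^2}$, $\theta_{\max}=\vartheta+\varepsilon$, $\tilde\theta_{\max}=2\vartheta+\varepsilon$, and $$\mathrm{Proj}_\Gamma(\theta,y,f)=\begin{cases}\Gamma y-\Gamma\dfrac{\nabla f(\theta)\nabla f(\theta)^T}{\nabla f(\theta)^T\Gamma\nabla f(\theta)}\Gamma y\,f(\theta)&\text{if }f(\theta)>0\text{ and }y^T\Gamma\nabla f(\theta)>0,\\ \Gamma y&\text{otherwise.}\end{cases}$$ *)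

(* Defs.v *)
From mathcomp Require Import all_boot all_order all_algebra.
From mathcomp Require Import complex.
From mathcomp Require Import all_classical all_reals all_analysis.

Set Implicit Arguments.
Unset Strict Implicit.
Unset Printing Implicit Defensive.

Import Order.TTheory GRing.Theory Num.Theory.
Import numFieldNormedType.Exports.

Local Open Scope classical_set_scope.
Local Open Scope ring_scope.

Definition dot (R : realType) (n : nat) (u v : 'cV[R]_n) : R :=
  (u^T *m v) 0 0.

(* The library's norm `|v| on matrices is the sup norm, hence this one. *)
Definition enorm (R : realType) (n : nat) (v : 'cV[R]_n) : R :=
  Num.sqrt (\sum_i v i 0 ^+ 2).

Definition opnorm (R : realType) (n : nat) (A : 'M[R]_n) : R :=
  sup [set enorm (A *m v) | v in [set v : 'cV[R]_n | enorm v <= 1]].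

Definition spectrum (R : realType) (n : nat) (A : 'M[R]_n) : set R[i] :=
  [set z | eigenvalue (map_mx (real_complex R) A) z].

Definition Hurwitz (R : realType) (n : nat) (A : 'M[R]_n) : Prop :=
  forall z, spectrum A z -> complex.Re z < 0.

(* - max_i Re lambda_i(A): for 0 < n the spectrum is finite and nonempty, so
   that the supremum is a maximum. *)
Definition sigma_of (R : realType) (n : nat) (A : 'M[R]_n) : R :=
  - sup [set complex.Re z | z in spectrum A].

Definition sym_posdef (R : realType) (n : nat) (P : 'M[R]_n) : Prop :=
  P^T = P /\ forall v : 'cV[R]_n, v != 0 -> 0 < dot v (P *m v).

Definition grad (R : realType) (n : nat) (f : 'cV[R]_n -> R) (p : 'cV[R]_n) :
    'cV[R]_n :=
  \col_i ('D_(delta_mx i 0) f p).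

Definition projf (R : realType) (n : nat) (vartheta eps : R)
    (theta : 'cV[R]_n) : R :=
  (enorm theta ^+ 2 - vartheta ^+ 2) / (2 * eps * vartheta + eps ^+ 2).

Definition Proj (R : realType) (n : nat) (Gamma : 'M[R]_n)
    (theta y : 'cV[R]_n) (f : 'cV[R]_n -> R) : 'cV[R]_n :=
  let g := grad f theta in
  if (0 < f theta) && (0 < dot y (Gamma *m g)) then
    Gamma *m y -
      f theta *: (Gamma *m ((dot g (Gamma *m g))^-1 *: (g *m g^T))
                    *m Gamma *m y)
  else Gamma *m y.

(* Classical epsilon-delta absolute continuity on [a, b]; the family of
   intervals ]u i, v i[ is finite and pairwise disjoint. *)
Definition abs_continuous (R : realType) (n : nat) (a b : R)
    (x : R -> 'cV[R]_n) : Prop :=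
  forall e : R, 0 < e -> exists2 d : R, 0 < d &
    forall (k : nat) (u v : 'I_k -> R),
      (forall i, a <= u i /\ u i <= v i /\ v i <= b) ->
      (forall i j, i != j -> v i <= u j \/ v j <= u i) ->
      \sum_i (v i - u i) < d ->
      \sum_i enorm (x (v i) - x (u i)) < e.

(* x' = F on [0, +oo[ in the sense of Caratheodory: the forcing term is only
   known to be bounded, so the equation is required almost everywhere.  When F
   is locally bounded, every classical solution is one in this sense. *)
Definition solves (R : realType) (n : nat) (x F : R -> 'cV[R]_n) : Prop :=
  (forall T : R, 0 <= T -> abs_continuous 0 T x) /\
  {ae (@lebesgue_measure R), forall t : R, 0 < t -> is_derive t 1 x (F t)}.

(* Main.v *)
Require Import Defs.
From mathcomp Require Import all_boot all_order all_algebra.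
From mathcomp Require Import ring lra zify complex.
From mathcomp Require Import all_classical all_reals all_analysis.
Import Order.TTheory GRing.Theory Num.Theory.
Import numFieldNormedType.Exports.
Local Open Scope classical_set_scope.
Local Open Scope ring_scope.

(* Along trajectories V = e^T P e + |theta - theta_star|^2 / gamma satisfies
   V' <= - |e|^2 almost everywhere: the projection term only helps, because its
   direction theta has a nonnegative product with theta - theta_star once
   |theta| exceeds the known bound.  The projection also keeps |theta| below
   theta_max, so V' <= - mu (V - K), and the integral bound follows by
   integrating V' <= - |e|^2.  The constant m comes from an upper bound on P:
   after a unitary triangularization of A_m, geometric weights on the
   coordinates give a quadratic form Q with Abar^T Q + Q Abar <= - I and
   Q <= m^2 / (sigma + 2 ell), and P <= Q by comparison.  Since solutions are
   only absolutely continuous, "V' <= 0 a.e. implies V nonincreasing" is proved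
   by covering the exceptional null set with a small open set and chaining local
   estimates. *)

(** The comparison of [P] with [Q] is algebraic and involves no matrix exponential. If the least
    [l >= 1] with [P <= l Q] were above 1, then [D = l Q - P] would be semidefinite with
    [2 <D v, Abar v> <= - (l - 1) |v|^2]; this forces [D] to be definite and lets [l] decrease. The
    rate [sigma + 2 ell] has its origin in the triangular form: each coordinate decays at rate
    [2 sigma + 2 ell], and one [sigma] pays for the off-diagonal entries. Returning from V to
    [|e|^2] needs a lower bound on [P] as well. For large [ell] both the lower and the upper bound
    are of order [1 / ell], so their quotient stays bounded and [kappa1], [kappa2] can be chosen
    free of [ell]. The residual term is [1 / gamma] divided by the lower bound, hence of order
    [(sigma + ell) / gamma], which is [1 / rho]. *)

(** * Euclidean inner product, semidefinite forms and the operator norm *)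

Section Euclidean.
Context {R : realType} {n : nat}.
Implicit Types (u v w : 'cV[R]_n) (A D : 'M[R]_n).

Lemma dotE u v : dot u v = \sum_i u i 0 * v i 0.
Proof. by rewrite /dot mxE; apply: eq_bigr => i _; rewrite mxE. Qed.

Lemma dotC u v : dot u v = dot v u.
Proof. by rewrite !dotE; apply: eq_bigr => i _; rewrite mulrC. Qed.

Lemma dotDr u v w : dot u (v + w) = dot u v + dot u w.
Proof. by rewrite /dot mulmxDr mxE. Qed.

Lemma dotDl u v w : dot (u + v) w = dot u w + dot v w.
Proof. by rewrite dotC dotDr !(dotC w). Qed.

Lemma dotZr c u v : dot u (c *: v) = c * dot u v.
Proof. by rewrite /dot -scalemxAr mxE. Qed.

Lemma dotZl c u v : dot (c *: u) v = c * dot u v.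
Proof. by rewrite dotC dotZr dotC. Qed.

Lemma dotNr u v : dot u (- v) = - dot u v.
Proof. by rewrite /dot mulmxN mxE. Qed.

Lemma dot0r u : dot u 0 = 0.
Proof. by rewrite /dot mulmx0 mxE. Qed.

Lemma dotNl u v : dot (- u) v = - dot u v.
Proof. by rewrite dotC dotNr dotC. Qed.

Lemma dot_mulmx A u v : dot u (A *m v) = dot (A^T *m u) v.
Proof. by rewrite /dot trmx_mul trmxK mulmxA. Qed.

Lemma dot_outer u v w : v *m (w^T *m u) = dot w u *: v.
Proof.
by rewrite [w^T *m u]mx11_scalar mul_mx_scalar.
Qed.

Lemma dot_ge0 v : 0 <= dot v v.
Proof. by rewrite dotE sumr_ge0// => i _; rewrite -expr2 sqr_ge0. Qed.

Lemma enorm_sqr v : enorm v ^+ 2 = dot v v.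
Proof.
rewrite /enorm sqr_sqrtr ?sumr_ge0 // => [|i _]; last exact: sqr_ge0.
by rewrite dotE; apply: eq_bigr => i _; rewrite expr2.
Qed.

Lemma enorm_ge0 v : 0 <= enorm v. Proof. exact: sqrtr_ge0. Qed.

Lemma enorm_sqrt v : enorm v = Num.sqrt (dot v v).
Proof. by rewrite -enorm_sqr sqrtr_sqr ger0_norm ?enorm_ge0. Qed.

(** The form [D] at [u + t v] is a quadratic in [t] that never goes negative, so its discriminant
    has a sign. As [D] is only semidefinite, a vanishing leading coefficient is a separate case. *)
Lemma psd_cauchy D u v : D^T = D -> (forall w, 0 <= dot w (D *m w)) ->
  dot u (D *m v) ^+ 2 <= dot u (D *m u) * dot v (D *m v).
Proof.
move=> sD pD; set c := dot u (D *m u); set b := dot u _; set a := dot v _.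
have q t : 0 <= a * t ^+ 2 + 2 * b * t + c.
  have := pD (u + t *: v).
  rewrite mulmxDr -scalemxAr !dotDl !dotDr !dotZl !dotZr.
  have -> : dot v (D *m u) = b by rewrite dot_mulmx sD dotC.
  by rewrite -/a -/b -/c; congr (_ <= _); ring.
have a0 : 0 <= a := pD v.
have [a00|an0] := eqVneq a 0.
  have [b0|bn0] := eqVneq b 0; first by rewrite a00 b0 mulr0 expr2 mulr0.
  (* With [a = 0] the quadratic is affine, and this [t] would give it the value -1. *)
  have := q (- (c + 1) / (2 * b)).
  rewrite a00 mul0r add0r mulrC divfK; last by rewrite mulf_neq0 ?pnatr_eq0.
  by rewrite addrC opprD addrA subrr add0r ler0N1.
have ap : 0 < a by rewrite lt_neqAle eq_sym an0 a0.
have := q (- b / a).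
have -> : a * (- b / a) ^+ 2 + 2 * b * (- b / a) + c = (c * a - b ^+ 2) / a.
  by field.
by rewrite ler_pdivlMr// mul0r subr_ge0.
Qed.

Lemma cauchy_schwarz u v : dot u v <= enorm u * enorm v.
Proof.
have := @psd_cauchy 1%:M u v (trmx1 _ _).
rewrite !mul1mx -!enorm_sqr -exprMn => /(_ _).
have h : forall w, 0 <= dot w (1%:M *m w) by move=> w; rewrite mul1mx dot_ge0.
move=> /(_ h); apply: contraTT; rewrite -!ltNge => lt.
rewrite ltr_pXn2r// nnegrE ?mulr_ge0 ?enorm_ge0//.
by rewrite (le_trans _ (ltW lt))// mulr_ge0 ?enorm_ge0.
Qed.

Lemma sqr_le_sqrt (x y : R) : 0 <= y -> (x ^+ 2 <= y ^+ 2) -> x <= y.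
Proof.
move=> y0; apply: contraTT; rewrite -!ltNge => lt.
by rewrite ltr_pXn2r// nnegrE (le_trans y0 (ltW lt)).
Qed.

Lemma enormN v : enorm (- v) = enorm v.
Proof. by rewrite !enorm_sqrt dotNl dotNr opprK. Qed.

Lemma enormZ c v : enorm (c *: v) = `|c| * enorm v.
Proof.
by rewrite !enorm_sqrt dotZl dotZr mulrA -expr2 sqrtrM ?sqr_ge0// sqrtr_sqr.
Qed.

Lemma enormD u v : enorm (u + v) <= enorm u + enorm v.
Proof.
apply: sqr_le_sqrt; first by rewrite addr_ge0 ?enorm_ge0.
rewrite sqrrD !enorm_sqr dotDl !dotDr (dotC v u).
have := cauchy_schwarz u v; lra.
Qed.

Lemma coord_le_enorm v i : `|v i 0| <= enorm v.
Proof.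
apply: sqr_le_sqrt; first exact: enorm_ge0.
rewrite real_normK ?num_real// enorm_sqr dotE (bigD1 i)//= -expr2 lerDl.
by rewrite sumr_ge0// => j _; rewrite -expr2 sqr_ge0.
Qed.

Lemma dot_eq0 v : (dot v v == 0) = (v == 0).
Proof.
apply/idP/idP => [/eqP v0|/eqP->]; last by rewrite /dot mulmx0 mxE.
apply/eqP/colP => i; rewrite mxE; apply/eqP.
have := coord_le_enorm v i.
by rewrite enorm_sqrt v0 sqrtr0 normr_le0.
Qed.

(** The squared Frobenius norm serves as [K]. The bound makes the supremum in [opnorm] finite. *)
Lemma mulmx_bounded A : exists2 K : R, 0 <= K &
  forall v, dot (A *m v) (A *m v) <= K * dot v v.
Proof.
exists (\sum_i dot (row i A)^T (row i A)^T).
  by rewrite sumr_ge0// => i _; exact: dot_ge0.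
move=> v; rewrite dotE mulr_suml ler_sum// => i _; rewrite -expr2.
have -> : (A *m v) i 0 = dot (row i A)^T v.
  by rewrite dotE mxE; apply: eq_bigr => j _; rewrite !mxE.
have := @psd_cauchy 1%:M (row i A)^T v (trmx1 _ _); rewrite !mul1mx; apply.
by move=> w; rewrite mul1mx dot_ge0.
Qed.

Lemma form_bounded A : exists2 K : R, 0 <= K &
  forall v, dot v (A *m v) <= K * dot v v.
Proof.
have [K K0 AK] := mulmx_bounded A; exists (1 + K); first by rewrite addr_ge0.
move=> v; have h := dot_ge0 (v - A *m v); have := AK v; move: h.
rewrite dotDl !dotDr !dotNl !dotNr opprK (dotC _ v).
have := dot_ge0 (A *m v); have := dot_ge0 v.
set a := dot v v; set b := dot v _; set c := dot (A *m v) _; lra.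
Qed.

(** Cauchy-Schwarz for the form [D] at [w = D v] and [v] bounds [|w|^4] by [<w, D w> <v, D v>], and
    one factor [|w|^2] cancels. Neither a square root nor an eigenbasis of [D] is involved. *)
Lemma psd_mulmx_le D (K : R) v : D^T = D -> (forall w, 0 <= dot w (D *m w)) ->
  (forall w, dot w (D *m w) <= K * dot w w) ->
  dot (D *m v) (D *m v) <= K * dot v (D *m v).
Proof.
move=> sD pD DK; set w := D *m v.
have := psd_cauchy D w v sD pD; rewrite -/w => h.
have [w0|wn0] := eqVneq w 0.
  by rewrite w0 !dot0r mulr0.
have wp : 0 < dot w w by rewrite lt_neqAle dot_ge0 andbT eq_sym dot_eq0.
rewrite -(ler_pM2l wp) -expr2 (le_trans h)//.
have := ler_wpM2r (pD v) (DK w); rewrite -/w; congr (_ <= _); ring.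
Qed.

Lemma opnorm_ge0 A : 0 <= opnorm A.
Proof.
have [K K0 AK] := mulmx_bounded A.
apply: ub_le_sup; last first.
  exists 0 => /=; first by rewrite enorm_sqrt dot0r sqrtr0.
  by rewrite mulmx0 enorm_sqrt dot0r sqrtr0.
exists (Num.sqrt K) => _ [w /= w1 <-].
rewrite enorm_sqrt ler_sqrt// (le_trans (AK w))//.
by rewrite -enorm_sqr ler_piMr// exprn_ile1 ?enorm_ge0.
Qed.

Lemma opnorm_le A v : enorm (A *m v) <= opnorm A * enorm v.
Proof.
have [K K0 AK] := mulmx_bounded A.
have hs : has_sup [set enorm (A *m v) | v in [set v | enorm v <= 1]].
  split.
    exists (enorm (A *m 0)), 0 => //=.
    by rewrite enorm_sqrt dot0r sqrtr0.
  exists (Num.sqrt K) => _ [w /= w1 <-].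
  rewrite enorm_sqrt ler_sqrt// (le_trans (AK w))//.
  by rewrite -enorm_sqr ler_piMr// exprn_ile1 ?enorm_ge0.
have [->|vn0] := eqVneq v 0.
  by rewrite mulmx0 enorm_sqrt dot0r sqrtr0 mulr0.
have vp : 0 < enorm v.
  by rewrite enorm_sqrt sqrtr_gt0 lt_neqAle dot_ge0 andbT eq_sym dot_eq0.
rewrite -ler_pdivrMr//; apply: ub_le_sup; first exact: hs.2.
exists ((enorm v)^-1 *: v) => /=.
  by rewrite enormZ ger0_norm ?invr_ge0 ?enorm_ge0// mulVf// gt_eqF.
by rewrite -scalemxAr enormZ ger0_norm ?invr_ge0 ?enorm_ge0// mulrC.
Qed.

Lemma opnorm_sqr_le A v : dot (A *m v) (A *m v) <= opnorm A ^+ 2 * dot v v.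
Proof.
rewrite -!enorm_sqr -exprMn ler_pXn2r ?opnorm_le//.
  by rewrite nnegrE enorm_ge0.
by rewrite nnegrE mulr_ge0 ?enorm_ge0 ?opnorm_ge0.
Qed.

End Euclidean.

(** * Comparison of solutions of a Lyapunov equation and inequality *)

Section Lyapunov.
Context {R : realType} {n : nat}.
Implicit Types (v w : 'cV[R]_n) (A P Q : 'M[R]_n).

Lemma lyapunov_compare A P Q (k : R) : P^T = P -> Q^T = Q ->
  0 < k -> (forall v, k * dot v v <= dot v (Q *m v)) ->
  (forall v, 2 * dot (P *m v) (A *m v) = - dot v v) ->
  (forall v, 2 * dot (Q *m v) (A *m v) <= - dot v v) ->
  forall v, dot v (P *m v) <= dot v (Q *m v).
Proof.
move=> sP sQ k0 kQ eP leQ.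
have [KP KP0 leKP] := form_bounded P.
have [KQ KQ0 leKQ] := form_bounded Q.
have [KA KA0 leKA] := mulmx_bounded A.
have Q0 v : 0 <= dot v (Q *m v).
  by rewrite (le_trans _ (kQ v))// mulr_ge0 ?dot_ge0 ?ltW.
(* The constraint [1 <= l] bounds the set below and reduces the claim to showing that its infimum is
   1. *)
pose S := [set l : R | 1 <= l /\ forall v, dot v (P *m v) <= l * dot v (Q *m v)].
have S0 : S !=set0.
  exists (1 + KP / k); split; first by rewrite lerDl divr_ge0 // ltW.
  move=> v; rewrite (le_trans (leKP v))// mulrDl mul1r.
  have := ler_wpM2l (divr_ge0 KP0 (ltW k0)) (kQ v).
  by rewrite mulrA divfK ?gt_eqF// => /le_trans; apply; rewrite lerDr.
have S1 : lbound S 1 by move=> l [].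
have Slb : has_lbound S by exists 1.
have infS : has_inf S by split.
set l := inf S.
have l1 : 1 <= l by apply: lb_le_inf.
have lS v : dot v (P *m v) <= l * dot v (Q *m v).
  have [Qv0|Qvn0] := eqVneq (dot v (Q *m v)) 0.
    have [l' [_ /(_ v)]] := S0; by rewrite Qv0 !mulr0.
  have Qvp : 0 < dot v (Q *m v) by rewrite lt_neqAle eq_sym Qvn0 Q0.
  rewrite -ler_pdivrMr//; apply: lb_le_inf => // l' [_ h].
  by rewrite ler_pdivrMr.
have [l1e|ln1] := eqVneq l 1; first by move=> v; have := lS v; rewrite l1e mul1r.
have l1p : 1 < l by rewrite lt_neqAle eq_sym ln1 l1.
pose D := l *: Q - P.
have DE v w : dot v (D *m w) = l * dot v (Q *m w) - dot v (P *m w).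
  by rewrite /D mulmxBl -scalemxAl dotDr dotNr dotZr.
have sD : D^T = D by rewrite /D linearB/= linearZ/= sP sQ.
have pD v : 0 <= dot v (D *m v) by rewrite DE subr_ge0.
have [KD KD0 leKD] := form_bounded D.
(* The Lyapunov relations give [(l - 1) |v|^2 <= 2 |D v| |A v|]. Squaring and using
   [|D v|^2 <= KD <v, D v>] turns this into a positive lower bound on the form [D]. *)
have main v : (l - 1) ^+ 2 * dot v v <= 4 * KA * KD * dot v (D *m v).
  have h1 : (l - 1) * dot v v <= 2 * (enorm (D *m v) * enorm (A *m v)).
    have : (l - 1) * dot v v <= - 2 * dot (D *m v) (A *m v).
      rewrite dotC DE !(dotC (A *m v)).
      by have := ler_wpM2l (ltW (lt_le_trans ltr01 l1)) (leQ v);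
         have := eP v; lra.
    have := cauchy_schwarz (- (D *m v)) (A *m v).
    by rewrite enormN dotNl; lra.
  have := psd_mulmx_le D KD v sD pD leKD.
  have := leKA v; have := dot_ge0 v.
  have [->|vn0] := eqVneq v 0.
    by rewrite !mulmx0 !dot0r !mulr0.
  have vp : 0 < dot v v by rewrite lt_neqAle dot_ge0 andbT eq_sym dot_eq0.
  move=> _ h2 h3.
  rewrite -(ler_pM2r vp).
  have -> : (l - 1) ^+ 2 * dot v v * dot v v = ((l - 1) * dot v v) ^+ 2 by ring.
  apply: (@le_trans _ _ ((2 * (enorm (D *m v) * enorm (A *m v))) ^+ 2)).
    rewrite ler_pXn2r// nnegrE ?mulr_ge0 ?enorm_ge0 ?subr_ge0 ?dot_ge0//.
  rewrite !exprMn !enorm_sqr.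
  have := ler_pM (dot_ge0 _) (dot_ge0 _) h3 h2.
  by set x := dot v _; set y := dot v v; set z := _ * dot (A *m v) _; lra.
pose C := 4 * KA * KD + 1.
have C0 : 0 < C by rewrite /C ltr_wpDl// !mulr_ge0.
pose d := (l - 1) ^+ 2 / C.
have d0 : 0 < d by rewrite /d divr_gt0// exprn_gt0// subr_gt0.
have dD v : d * dot v v <= dot v (D *m v).
  rewrite /d mulrAC ler_pdivrMr// (le_trans (main v))// mulrC.
  by rewrite ler_wpM2l// /C lerDl.
(* The first entry keeps [e Q] below [d I], hence below [D]; the second keeps [l - e >= 1]. The
   [+ 1] avoids dividing by a [KQ] known only to be nonnegative. *)
pose e := Num.min (d / (KQ + 1)) (l - 1).
have e0 : 0 < e by rewrite /e lt_min subr_gt0 l1p andbT divr_gt0// ltr_wpDl.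
have eS : S (l - e).
  split.
    have : e <= l - 1 by rewrite /e ge_min lexx orbT.
    by lra.
  move=> v; have := dD v; rewrite DE.
  have : e * dot v (Q *m v) <= d * dot v v.
    apply: (@le_trans _ _ (e * (KQ * dot v v))).
      by rewrite ler_wpM2l// ltW.
    rewrite mulrA ler_wpM2r ?dot_ge0//.
    apply: (@le_trans _ _ (d / (KQ + 1) * KQ)).
      by rewrite ler_wpM2r// /e ge_min lexx.
    rewrite mulrAC ler_pdivrMr ?ltr_wpDl// ler_wpM2l// ?ltW//; lra.
  by lra.
have := ge_inf Slb eS; rewrite -/l; lra.
Qed.

End Lyapunov.

(** * Complex columns and the action of real matrices on them *)

Section ComplexColumns.
Local Open Scope sesquilinear_scope.
Context {R : realType} {n : nat}.
Local Notation C := R[i].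
Local Notation "M %:CM" := (map_mx (real_complex R) M) (at level 2).
Implicit Types (z : 'cV[C]_n) (U : 'M[C]_n) (A : 'M[R]_n).

Definition Re2Im2 (c : C) : R := complex.Re c ^+ 2 + complex.Im c ^+ 2.

Definition sqnorm z : R := \sum_i Re2Im2 (z i 0).

Lemma Re2Im2_ge0 c : 0 <= Re2Im2 c.
Proof. by rewrite addr_ge0 ?sqr_ge0. Qed.

Lemma sqnormE z : (sqnorm z)%:C%C = (z^t* *m z) 0 0.
Proof.
rewrite /sqnorm rmorph_sum mxE; apply: eq_bigr => i _.
by rewrite !mxE [LHS]add_Re2_Im2 normCKC.
Qed.

Lemma sqnorm_unitary U z : U \is unitarymx -> sqnorm (U *m z) = sqnorm z.
Proof.
move=> uU; apply: complexI; rewrite !sqnormE trmx_mul map_mxM mulmxA.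
by rewrite (mulmxKtV _ uU).
Qed.

Lemma Re_sum (I : finType) (F : I -> C) :
  complex.Re (\sum_i F i) = \sum_i complex.Re (F i).
Proof. by apply: (big_morph (@complex.Re R)) => // [[x1 x2] [y1 y2]]. Qed.

Lemma Im_sum (I : finType) (F : I -> C) :
  complex.Im (\sum_i F i) = \sum_i complex.Im (F i).
Proof. by apply: (big_morph (@complex.Im R)) => // [[x1 x2] [y1 y2]]. Qed.

Lemma sqnorm_ReIm z : sqnorm z =
  dot (map_mx (@complex.Re R) z) (map_mx (@complex.Re R) z)
  + dot (map_mx (@complex.Im R) z) (map_mx (@complex.Im R) z).
Proof.
rewrite !dotE -big_split; apply: eq_bigr => i _.
by rewrite !mxE /Re2Im2 !expr2.
Qed.

Lemma Re_mulmx_real A z : map_mx (@complex.Re R) (A%:CM *m z) =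
  A *m map_mx (@complex.Re R) z.
Proof.
apply/colP => i; rewrite !mxE Re_sum; apply: eq_bigr => j _; rewrite !mxE.
by case: (z j 0) => x y /=; rewrite mul0r subr0.
Qed.

Lemma Im_mulmx_real A z : map_mx (@complex.Im R) (A%:CM *m z) =
  A *m map_mx (@complex.Im R) z.
Proof.
apply/colP => i; rewrite !mxE Im_sum; apply: eq_bigr => j _; rewrite !mxE.
by case: (z j 0) => x y /=; rewrite mul0r addr0.
Qed.

(** A real matrix acts on the real and imaginary parts separately, so complexification does not
    enlarge [opnorm]. *)
Lemma sqnorm_mulmx_real A z :
  sqnorm (A%:CM *m z) <= opnorm A ^+ 2 * sqnorm z.
Proof.
rewrite !sqnorm_ReIm Re_mulmx_real Im_mulmx_real mulrDr.
by rewrite lerD ?opnorm_sqr_le.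
Qed.

Lemma sqnorm_real (v : 'cV[R]_n) : sqnorm v%:CM = dot v v.
Proof.
rewrite dotE; apply: eq_bigr => i _.
by rewrite mxE /Re2Im2 /= expr0n addr0 expr2.
Qed.

Lemma sqnorm_coord z i : Re2Im2 (z i 0) <= sqnorm z.
Proof.
rewrite /sqnorm (bigD1 i)//= lerDl sumr_ge0// => j _.
exact: Re2Im2_ge0.
Qed.

End ComplexColumns.

(** * Unitary triangularization and the spectral abscissa *)

Section SchurLyapunov.
Local Open Scope sesquilinear_scope.
Context {R : realType} {n : nat}.
Local Notation C := R[i].
Local Notation "M %:CM" := (map_mx (real_complex R) M) (at level 2).
Variable A : 'M[R]_n.

(** [is_trig_mx] means lower triangular: row [i] of [T] sees only the coordinates up to [i], which
    fixes the direction of the weights used later. *)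
Lemma schur_real : (0 < n)%N -> exists U T : 'M[C]_n,
  [/\ U \is unitarymx, U *m A%:CM = T *m U, is_trig_mx T &
   forall i, spectrum A (T i i)].
Proof.
move=> n0; have [U uU tU] := Schur A%:CM n0.
exists U, (U *m A%:CM *m U^t*).
have UAT : U *m A%:CM = U *m A%:CM *m U^t* *m U by rewrite (mulmxKtV _ uU).
have tT : is_trig_mx (U *m A%:CM *m U^t*).
  by move: tU; rewrite /similar_to conjymx.
split => // i; rewrite /spectrum /= /eigenvalue /eigenspace kermx_eq0.
rewrite row_free_unit; set l := (_ i i).
have -> : A%:CM - l%:M = U^t* *m (U *m A%:CM *m U^t* - l%:M) *m U.
  rewrite mulmxBr mulmxBl -!mulmxA -!invmx_unitary// mulVmx ?unitarymx_unit//.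
  by rewrite mulKmx ?unitarymx_unit// mulmx1 mul_scalar_mx -scalemxAr mulVmx
    ?unitarymx_unit// scalemx1.
rewrite unitmxE !det_mulmx unitfE negbK.
suff -> : \det (U *m A%:CM *m U^t* - l%:M) = 0 by rewrite mulr0 mul0r.
rewrite det_trig.
  by rewrite (bigD1 i)//= mxE [X in _ + X]mxE [X in _ - X]mxE eqxx subrr mul0r.
apply/is_trig_mxP => j k jk; rewrite mxE (is_trig_mxP tT _ _ jk) add0r !mxE.
by rewrite -val_eqE /= ltn_eqF// oppr0.
Qed.

Lemma sigma_of_ge (z : C) : Hurwitz A -> spectrum A z ->
  sigma_of A <= - complex.Re z.
Proof.
move=> hA sz; rewrite lerN2; apply: ub_le_sup; last by exists z.
by exists 0 => _ [w /= sw <-]; rewrite ltW// hA.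
Qed.

(** A supremum of negative numbers may be 0; it is negative here because every eigenvalue is one of
    the finitely many diagonal entries of [T]. *)
Lemma sigma_of_gt0 : (0 < n)%N -> Hurwitz A -> 0 < sigma_of A.
Proof.
move=> n0 hA; rewrite /sigma_of oppr_gt0.
have [U [T [uU UA tT sT]]] := schur_real n0.
pose M := \big[Order.max/complex.Re (T (Ordinal n0) (Ordinal n0))]_i
  complex.Re (T i i).
have M0 : M < 0.
  rewrite /M; elim/big_ind: _ => [|x y x0 y0|i _]; last by apply: hA.
    exact: hA.
  by rewrite gt_max x0 y0.
apply: le_lt_trans M0; apply: ge_sup.
  by eexists; exists (T (Ordinal n0) (Ordinal n0)).
move=> _ [z /= sz <-].
suff [i ->] : exists i, z = T i i by rewrite /M le_bigmax.
move: sz; rewrite /spectrum /= /eigenvalue /eigenspace kermx_eq0 row_free_unit.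
have -> : A%:CM - z%:M = U^t* *m (T - z%:M) *m U.
  rewrite mulmxBr mulmxBl -!mulmxA -UA -!invmx_unitary//.
  by rewrite mulKmx ?unitarymx_unit// mul_scalar_mx -scalemxAr mulVmx
    ?unitarymx_unit// scalemx1.
rewrite unitmxE !det_mulmx unitfE negbK 2!mulf_eq0.
have uneq0 (V : 'M[C]_n) : V \is unitarymx -> \det V == 0 = false.
  by move=> uV; apply/negbTE; rewrite -unitfE -unitmxE unitarymx_unit.
rewrite (uneq0 U)// (uneq0 (U^t*)) ?trmxC_unitary// orbF /= det_trig.
  move=> /prodf_eq0[i _]; rewrite !mxE eqxx mulr1n subr_eq0 => /eqP <-.
  by exists i.
apply/is_trig_mxP => j k jk; rewrite mxE (is_trig_mxP tT _ _ jk) add0r !mxE.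
by rewrite -val_eqE /= ltn_eqF// oppr0.
Qed.

End SchurLyapunov.

(** * A weighted quadratic form adapted to the triangular basis *)

Section SchurForm.
Local Open Scope sesquilinear_scope.
Context {R : realType} {n : nat}.
Local Notation C := R[i].
Local Notation "M %:CM" := (map_mx (real_complex R) M) (at level 2).

(** The off-diagonal part is kept as all of [T] applied to a truncated column, because the norm of
    [T] is known and that of its strictly triangular part is not. *)
Lemma trig_mulmx (T : 'M[C]_n) (z : 'cV[C]_n) (i : 'I_n) : is_trig_mx T ->
  (T *m z) i 0 = T i i * z i 0 +
    (T *m \col_j (if (j < i)%N then z j 0 else 0)) i 0.
Proof.
move=> /is_trig_mxP tT; rewrite !mxE (bigD1 i)//=; congr (_ + _).
rewrite [RHS](bigD1 i)//= mxE ltnn mulr0 add0r; apply: eq_bigr => j ji.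
rewrite mxE; case: ltnP => // ij.
by rewrite tT ?mul0r// ltn_neqAle eq_sym ij andbT.
Qed.

(* The weighted AM-GM inequality makes the off-diagonal part of row i cost
   only half of the decay of the i-th coordinate. *)
Lemma trig_row_decay (A : 'M[R]_n) (U T : 'M[C]_n) (z : 'cV[C]_n) (i : 'I_n)
    (sg : R) :
  U \is unitarymx -> U *m A%:CM = T *m U -> is_trig_mx T ->
  0 < sg -> sg <= - complex.Re (T i i) ->
  2 * (complex.Re (z i 0) * complex.Re ((T *m z) i 0)
       + complex.Im (z i 0) * complex.Im ((T *m z) i 0))
  <= - sg * Re2Im2 (z i 0)
     + opnorm A ^+ 2 / sg * \sum_(j < n | (j < i)%N) Re2Im2 (z j 0).
Proof.
move=> uU UA tT sg0 sgT; rewrite (trig_mulmx _ _ _ tT).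
set z' := \col_j _; set s := (T *m z') i 0.
(* [T] is unitarily similar to [A], so the whole off-diagonal row costs a single factor
   [opnorm A ^+ 2], without dependence on the dimension. *)
have sE : Re2Im2 s <= opnorm A ^+ 2 * \sum_(j < n | (j < i)%N) Re2Im2 (z j 0).
  have -> : \sum_(j < n | (j < i)%N) Re2Im2 (z j 0) = sqnorm z'.
    rewrite big_mkcond; apply: eq_bigr => j _; rewrite mxE.
    by case: ifP => // _; rewrite /Re2Im2 /= expr0n addr0.
  apply: (le_trans (sqnorm_coord (T *m z') i)).
  have -> : T *m z' = U *m (A%:CM *m (U^t* *m z')).
    by rewrite !mulmxA UA -(mulmxA T) (unitarymxP uU) mulmx1.
  rewrite (sqnorm_unitary _ _ uU) (le_trans (sqnorm_mulmx_real _ _))//.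
  by rewrite sqnorm_unitary ?trmxC_unitary.
move: sE sgT; case: s => c d; case: (T i i) => al be; case: (z i 0) => p q.
rewrite /Re2Im2 /=; set S := \sum_(j < n | _) _ => sE sgT.
have h : 2 * (p * c + q * d) <= sg * (p ^+ 2 + q ^+ 2) + (c ^+ 2 + d ^+ 2) / sg.
  have -> : sg * (p ^+ 2 + q ^+ 2) + (c ^+ 2 + d ^+ 2) / sg =
    2 * (p * c + q * d) + ((sg * p - c) ^+ 2 + (sg * q - d) ^+ 2) / sg.
    by field; rewrite gt_eqF.
  by rewrite lerDl divr_ge0 ?addr_ge0 ?sqr_ge0// ltW.
have h2 : (c ^+ 2 + d ^+ 2) / sg <= opnorm A ^+ 2 / sg * S.
  by rewrite mulrAC ler_wpM2r// invr_ge0 ltW.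
have h3 : sg * (p ^+ 2 + q ^+ 2) <= - al * (p ^+ 2 + q ^+ 2).
  by rewrite ler_wpM2r// addr_ge0 ?sqr_ge0.
have -> : 2 * (p * (al * p - be * q + c) + q * (al * q + be * p + d)) =
  2 * (p * c + q * d) + 2 * (al * (p ^+ 2 + q ^+ 2)) by ring.
by lra.
Qed.

(** A telescoping sum; up to normalization it is the weight of all rows whose off-diagonal part
    involves coordinate [j]. *)
Lemma geometric_tail (c : R) (j : 'I_n) :
  (c - 1) * \sum_(i < n | (j < i)%N) c ^+ (n.-1 - i) = c ^+ (n.-1 - j) - 1.
Proof.
rewrite -(big_geq_mkord j.+1 n xpredT (fun i => c ^+ (n.-1 - i))) mulr_sumr.
rewrite (@telescope_sumr_eq _ _ _ (fun i => - c ^+ (n - i))) => [| |i].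
- by rewrite opprK subnn expr0 addrC; congr (c ^+ _ - _); lia.
- exact: ltn_ord.
move=> /andP[ji iN]; have -> : (n - i = (n.-1 - i).+1)%N by lia.
have -> : (n - i.+1 = n.-1 - i)%N by lia.
by rewrite exprS; ring.
Qed.

(** Coordinate [j] is charged by every later row, so the weights are larger for small indices. The
    ratio [c] is chosen so that [(c - 1) * sg] is the AM-GM coefficient [opnorm A ^+ 2 / sg]; the
    geometric sum then balances the decay and leaves -1. *)
Lemma lyapunov_solution_exists (A : 'M[R]_n) (ell : R) : (0 < n)%N ->
  Hurwitz A -> 0 <= ell ->
  let sg := sigma_of A in
  let c := 1 + (opnorm A / sg) ^+ 2 in
  exists Q : 'M[R]_n, exists2 k : R, 0 < k &
    [/\ Q^T = Q,
        forall v, k * dot v v <= dot v (Q *m v),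
        forall v, dot v (Q *m v) <= c ^+ n.-1 / (sg + 2 * ell) * dot v v &
        forall v, 2 * dot (Q *m v) ((A - ell%:M) *m v) <= - dot v v].
Proof.
move=> n0 hA ell0 sg c.
have sg0 : 0 < sg := sigma_of_gt0 A n0 hA.
have [U [T [uU UA tT sT]]] := schur_real A n0.
have sl0 : 0 < sg + 2 * ell by rewrite ltr_pwDl// mulr_ge0.
have c1 : 1 <= c by rewrite lerDl sqr_ge0.
have c0 : 0 < c := lt_le_trans ltr01 c1.
pose d (i : 'I_n) := c ^+ (n.-1 - i) / (sg + 2 * ell).
have d0 i : 0 < d i by rewrite divr_gt0// exprn_gt0.
pose D := diag_mx (\row_i d i).
pose X := map_mx (@complex.Re R) U; pose Y := map_mx (@complex.Im R) U.
(* This is the real part of [U^* D U], which has the same quadratic form on real vectors. *)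
pose Q := X^T *m D *m X + Y^T *m D *m Y.
have UX (v : 'cV[R]_n) i : complex.Re ((U *m v%:CM) i 0) = (X *m v) i 0.
  rewrite !mxE Re_sum; apply: eq_bigr => j _; rewrite !mxE.
  by case: (U i j) => x y /=; rewrite mulr0 subr0.
have UY (v : 'cV[R]_n) i : complex.Im ((U *m v%:CM) i 0) = (Y *m v) i 0.
  rewrite !mxE Im_sum; apply: eq_bigr => j _; rewrite !mxE.
  by case: (U i j) => x y /=; rewrite mulr0 add0r mulrC.
have sQ : Q^T = Q by rewrite /Q linearD/= !trmx_mul !trmxK tr_diag_mx !mulmxA.
have QE (v w : 'cV[R]_n) : dot (Q *m v) w = \sum_i d i *
    (complex.Re ((U *m v%:CM) i 0) * complex.Re ((U *m w%:CM) i 0)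
     + complex.Im ((U *m v%:CM) i 0) * complex.Im ((U *m w%:CM) i 0)).
  rewrite dotC dot_mulmx sQ /Q mulmxDl dotDl -!mulmxA.
  have aux (Z : 'M[R]_n) : dot (Z^T *m (D *m (Z *m w))) v =
      \sum_i d i * ((Z *m v) i 0 * (Z *m w) i 0).
    rewrite dotC dot_mulmx trmxK dotE; apply: eq_bigr => i _.
    by rewrite /D mul_diag_mx [X in _ * X]mxE [X in _ * (X * _)]mxE mulrCA.
  rewrite !aux -big_split; apply: eq_bigr => i _ /=.
  by rewrite mulrDr !UX !UY.
have NE (v : 'cV[R]_n) : dot v v = \sum_i Re2Im2 ((U *m v%:CM) i 0).
  by rewrite -[RHS]/(sqnorm _) (sqnorm_unitary _ _ uU) sqnorm_real.
have QvE v : dot v (Q *m v) = \sum_i d i * Re2Im2 ((U *m v%:CM) i 0).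
  by rewrite dotC QE; apply: eq_bigr => i _; rewrite /Re2Im2 !expr2.
exists Q, (sg + 2 * ell)^-1; first by rewrite invr_gt0.
split => // v.
- rewrite NE QvE mulr_sumr ler_sum// => i _.
  rewrite ler_wpM2r ?Re2Im2_ge0// /d ler_peMl ?exprn_ege1//.
  by rewrite invr_ge0 ltW.
- rewrite NE QvE mulr_sumr ler_sum// => i _.
  rewrite ler_wpM2r ?Re2Im2_ge0// /d ler_wpM2r ?ler_weXn2l ?leq_subr//.
  by rewrite invr_ge0 ltW.
set z := U *m v%:CM.
have TzE : U *m (A *m v)%:CM = T *m z by rewrite map_mxM mulmxA UA -mulmxA.
rewrite mulmxBl mul_scalar_mx dotDr dotNr dotZr (dotC (Q *m v) v) QvE QE TzE.
rewrite -/z.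
pose a2 := opnorm A ^+ 2 / sg.
have step i : 2 * (d i * (complex.Re (z i 0) * complex.Re ((T *m z) i 0)
       + complex.Im (z i 0) * complex.Im ((T *m z) i 0)))
  <= - sg * (d i * Re2Im2 (z i 0))
     + \sum_(j < n | (j < i)%N) a2 * d i * Re2Im2 (z j 0).
  have := trig_row_decay A U T z i sg uU UA tT sg0 (sigma_of_ge A _ hA (sT i)).
  move=> /(ler_wpM2l (ltW (d0 i))); rewrite -mulr_sumr -/a2.
  by congr (_ <= _); ring.
(* The decay of coordinate [j] is [(sg + 2 * ell) * d j = c ^+ (n.-1 - j)], while the later rows
   charge it at most [c ^+ (n.-1 - j) - 1]. *)
have coef j : - sg * d j - 2 * ell * d j
    + a2 * \sum_(i < n | (j < i)%N) d i <= - 1.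
  rewrite /d -mulr_suml.
  set S := \sum_(i < n | _) _.
  have S0 : 0 <= S by rewrite sumr_ge0// => i _; rewrite exprn_ge0// ltW.
  have := geometric_tail c j; rewrite -/S => gS.
  have a2c : a2 <= (c - 1) * (sg + 2 * ell).
    have -> : a2 = (c - 1) * sg by rewrite /a2 /c; field; rewrite gt_eqF.
    by rewrite ler_wpM2l ?subr_ge0// lerDl mulr_ge0.
  have : a2 * (S / (sg + 2 * ell)) <= c ^+ (n.-1 - j) - 1.
    rewrite mulrA ler_pdivrMr// -gS [leRHS]mulrAC.
    by rewrite ler_wpM2r.
  have : (sg + 2 * ell) * (c ^+ (n.-1 - j) / (sg + 2 * ell)) = c ^+ (n.-1 - j).
    by field; rewrite gt_eqF.
  by set x := _ / _; lra.
rewrite NE -/z mulrBr.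
apply: (@le_trans _ _ (\sum_j (- sg * d j - 2 * ell * d j
    + a2 * \sum_(i < n | (j < i)%N) d i) * Re2Im2 (z j 0))); last first.
  by rewrite -sumrN ler_sum// => j _; rewrite -[leRHS]mulN1r ler_wpM2r ?Re2Im2_ge0.
apply: (@le_trans _ _ (\sum_i (- sg * (d i * Re2Im2 (z i 0))
     + \sum_(j < n | (j < i)%N) a2 * d i * Re2Im2 (z j 0))
     - 2 * (ell * \sum_i d i * Re2Im2 (z i 0)))).
  by rewrite lerD2r mulr_sumr ler_sum.
rewrite big_split/= (exchange_big_dep xpredT)//= mulrA mulr_sumr -sumrN.
rewrite addrAC -!big_split /= ler_sum// => j _.
rewrite -mulr_suml -mulr_sumr le_eqVlt; apply/orP; left; apply/eqP.
ring.
Qed.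

End SchurForm.

(** * Upper and lower bounds on [P] *)

Section LyapunovBounds.
Context {R : realType} {n : nat}.
Variables (A P : 'M[R]_n) (ell : R).
Hypotheses (n0 : (0 < n)%N) (hA : Hurwitz A) (ell0 : 0 <= ell).
Hypotheses (pP : sym_posdef P)
  (eqP : (A - ell%:M)^T *m P + P *m (A - ell%:M) = - 1%:M).
Let sg := sigma_of A.
Let a := opnorm A.
Let m := (1 + 4 * a / sg) ^+ n.-1.

Lemma sym_posdef_ge0 v : 0 <= dot v (P *m v).
Proof.
have [->|vn0] := eqVneq v 0; first by rewrite mulmx0 dot0r.
exact/ltW/pP.2.
Qed.

Lemma lyapunov_form v :
  2 * dot (P *m v) ((A - ell%:M) *m v) = - dot v v.
Proof.
have := congr1 (fun M => dot v (M *m v)) eqP.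
rewrite mulmxDl dotDr mulNmx mul1mx dotNr => <-.
rewrite -!mulmxA (dot_mulmx P) pP.1 (dot_mulmx _ v) trmxK.
by rewrite (dotC _ (P *m v)) mulr_natl mulr2n.
Qed.

Lemma lyapunov_le v : dot v (P *m v) <= m ^+ 2 / (sg + 2 * ell) * dot v v.
Proof.
have sg0 : 0 < sg := sigma_of_gt0 A n0 hA.
have a0 : 0 <= a := opnorm_ge0 A.
have [Q [k k0 [sQ kQ leQ lyQ]]] := lyapunov_solution_exists A ell n0 hA ell0.
apply: le_trans (lyapunov_compare _ _ _ k pP.1 sQ k0 kQ lyapunov_form lyQ v) _.
apply: le_trans (leQ v) _; rewrite ler_wpM2r ?dot_ge0//.
rewrite ler_wpM2r ?invr_ge0 ?addr_ge0 ?mulr_ge0 ?(ltW sg0)//.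
(* Comparing bases leaves [1 + q^2 <= (1 + 4 q)^2] with [q = a / sg >= 0]. *)
rewrite /m -exprM mulnC exprM lerXn2r ?nnegrE ?addr_ge0 ?sqr_ge0//.
rewrite -/sg -/a -mulrA; have : 0 <= a / sg by rewrite divr_ge0// ltW.
set q := a / sg => q0; have := sqr_ge0 q; nra.
Qed.

(** Cauchy-Schwarz in the Lyapunov equation gives [|v| <= 2 (a + ell) |P v|], and [|P v|^2] is at
    most the upper bound on [P] times [<v, P v>]. This avoids eigenvectors of [P]. *)
Lemma lyapunov_ge v :
  dot v v <= 4 * (a + ell) ^+ 2 * (m ^+ 2 / (sg + 2 * ell)) * dot v (P *m v).
Proof.
have [v0|vn0] := eqVneq v 0; first by rewrite v0 mulmx0 !dot0r mulr0.
have vp : 0 < dot v v by rewrite lt_neqAle dot_ge0 andbT eq_sym dot_eq0.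
have ev : 0 < enorm v by rewrite enorm_sqrt sqrtr_gt0.
have Av : enorm ((A - ell%:M) *m v) <= (a + ell) * enorm v.
  rewrite mulmxBl mul_scalar_mx mulrDl (le_trans (enormD _ _))//.
  by rewrite enormN enormZ ger0_norm// lerD2r opnorm_le.
have h1 : enorm v <= 2 * (a + ell) * enorm (P *m v).
  rewrite -(ler_pM2l ev) -expr2 enorm_sqr.
  have := cauchy_schwarz (- (P *m v)) ((A - ell%:M) *m v).
  rewrite enormN dotNl => h.
  have := lyapunov_form v.
  have := ler_wpM2l (enorm_ge0 (P *m v)) Av; lra.
have h2 : dot v v <= 4 * (a + ell) ^+ 2 * dot (P *m v) (P *m v).
  rewrite -!enorm_sqr.
  have -> : 4 * (a + ell) ^+ 2 * enorm (P *m v) ^+ 2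
    = (2 * (a + ell) * enorm (P *m v)) ^+ 2 by ring.
  by rewrite lerXn2r// nnegrE ?enorm_ge0// (le_trans (enorm_ge0 v)).
apply: le_trans h2 _; rewrite -[leRHS]mulrA ler_wpM2l//.
  by rewrite mulr_ge0 ?sqr_ge0.
by apply: psd_mulmx_le; [exact: pP.1|exact: sym_posdef_ge0|exact: lyapunov_le].
Qed.

End LyapunovBounds.

(** * Chaining local estimates along a segment *)

Section StraddleInduction.
Context {R : realType}.

(** Compactness of [[a, b]] in chaining form: the supremum of the points reachable from [a] is
    itself reachable, and could be passed if it were below [b]. Only intervals around [t] occur
    locally, since those are what a derivative at [t] controls. *)
Lemma straddle_induction (a b : R) (P : R -> R -> Prop) : a <= b ->
  (forall x y z, x <= y -> y <= z -> P x y -> P y z -> P x z) ->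
  (forall t, a <= t <= b -> exists2 r : R, 0 < r &
     forall s1 s2, a <= s1 -> s1 <= t -> t <= s2 -> s2 <= b ->
       t - r < s1 -> s2 < t + r -> P s1 s2) ->
  P a b.
Proof.
move=> ab trP locP.
pose S := [set t | a <= t <= b /\ P a t].
have aS : S a.
  split; first by rewrite lexx.
  have [|r r0 h] := locP a; first by rewrite lexx.
  by apply: h => //; lra.
have hsS : has_sup S by split; [exists a|exists b => t [/andP[_]]].
pose s := sup S.
have as_ : a <= s by apply: ub_le_sup aS; exact: hsS.2.
have sb : s <= b by apply: ge_sup => [|t [/andP[_]]]; [exists a|].
have [|r r0 h] := locP s; first by rewrite as_ sb.
have [s1 [/andP[as1 s1b] Ps1] s1r] := sup_adherent r0 hsS.
have s1s : s1 <= s by apply: ub_le_sup; [exact: hsS.2|split => //; rewrite as1].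
have step s2 : s <= s2 -> s2 <= b -> s2 < s + r -> P a s2.
  move=> ss2 s2b s2r; apply: (trP a s1 s2) => //; first by rewrite (le_trans s1s).
  exact: h.
have [->|sneb] := eqVneq b s; first by apply: step => //; lra.
have sltb : s < b by rewrite lt_neqAle eq_sym sneb sb.
pose s2 := Num.min b (s + r / 2).
have r2 : 0 < r / 2 by rewrite divr_gt0.
have s2s : s < s2 by rewrite /s2 lt_min sltb ltrDl.
have s2b : s2 <= b by rewrite /s2 ge_min lexx.
have s2r : s2 < s + r.
  by rewrite /s2 gt_min; apply/orP; right; rewrite ltrD2l; lra.
have : S s2.
  split; last by apply: step => //; exact: ltW.
  by rewrite s2b andbT (le_trans as_ (ltW s2s)).
move=> /(ub_le_sup hsS.2); rewrite leNgt => /negP[]; exact: s2s.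
Qed.

End StraddleInduction.

(** * Absolute continuity and monotonicity from an almost everywhere sign *)

Section AbsoluteContinuity.
Context {R : realType}.
Implicit Types (a b : R) (f g : R -> R).

Definition interval_family a b (k : nat) (u v : 'I_k -> R) : Prop :=
  (forall i, a <= u i /\ u i <= v i /\ v i <= b) /\
  (forall i j, i != j -> v i <= u j \/ v j <= u i).

Definition ac a b f : Prop :=
  forall e : R, 0 < e -> exists2 d : R, 0 < d &
    forall (k : nat) (u v : 'I_k -> R), interval_family a b k u v ->
      \sum_i (v i - u i) < d -> \sum_i `|f (v i) - f (u i)| < e.

Lemma abs_continuous_ac n a b (x : R -> 'cV[R]_n) f (C : R) :
  abs_continuous a b x ->
  (forall s t, a <= s -> s <= t -> t <= b ->
     `|f t - f s| <= C * enorm (x t - x s)) ->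
  ac a b f.
Proof.
move=> acx fx e e0.
have C0 : 0 < `|C| + 1 by rewrite ltr_wpDl.
have [d d0 h] := acx (e / (`|C| + 1)) (divr_gt0 e0 C0).
exists d => // k u v [uv dj] /(h k u v uv dj).
rewrite ltr_pdivlMr//; apply: le_lt_trans; rewrite mulrC mulr_sumr.
apply: ler_sum => i _; have [au [uvi vb]] := uv i.
apply: (le_trans (fx _ _ au uvi vb)).
rewrite ler_wpM2r ?enorm_ge0//.
by rewrite (le_trans (ler_norm C))// lerDl.
Qed.

(** The common source of the closure properties under sums and products. *)
Lemma ac_dominated a b f f1 f2 (C : R) : ac a b f1 -> ac a b f2 ->
  (forall s t, a <= s -> s <= t -> t <= b ->
     `|f t - f s| <= C * (`|f1 t - f1 s| + `|f2 t - f2 s|)) ->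
  ac a b f.
Proof.
move=> ac1 ac2 fx e e0.
have C0 : 0 < `|C| + 1 by rewrite ltr_wpDl.
have e2 : 0 < e / (`|C| + 1) / 2 by rewrite !divr_gt0.
have [d1 d10 h1] := ac1 _ e2; have [d2 d20 h2] := ac2 _ e2.
exists (Num.min d1 d2); first by rewrite lt_min d10.
move=> k u v fam; rewrite lt_min => /andP[/(h1 k u v fam) H1 /(h2 k u v fam) H2].
have := ltrD H1 H2; rewrite -splitr -big_split/= ltr_pdivlMr//.
apply: le_lt_trans; rewrite mulrC mulr_sumr.
apply: ler_sum => i _; have [au [uvi vb]] := fam.1 i.
apply: (le_trans (fx _ _ au uvi vb)).
rewrite ler_wpM2r ?addr_ge0//.
by rewrite (le_trans (ler_norm C))// lerDl.
Qed.

Lemma ac_lipschitz a b f (C : R) :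
  (forall s t, a <= s -> s <= t -> t <= b -> `|f t - f s| <= C * (t - s)) ->
  ac a b f.
Proof.
move=> fx e e0; have C0 : 0 < `|C| + 1 by rewrite ltr_wpDl.
exists (e / (`|C| + 1)); first by rewrite divr_gt0.
move=> k u v [uv _]; rewrite ltr_pdivlMr//; apply: le_lt_trans.
rewrite mulrC mulr_sumr; apply: ler_sum => i _; have [au [uvi vb]] := uv i.
apply: (le_trans (fx _ _ au uvi vb)); rewrite ler_wpM2r ?subr_ge0//.
by rewrite (le_trans (ler_norm C))// lerDl.
Qed.

Lemma ac_cst a b (c : R) : ac a b (fun=> c).
Proof.
by apply: (ac_lipschitz _ _ _ 0) => s t _ _ _; rewrite subrr normr0 mul0r.
Qed.

Lemma acD a b f g : ac a b f -> ac a b g -> ac a b (fun t => f t + g t).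
Proof.
move=> acf acg; apply: (ac_dominated _ _ _ _ _ 1 acf acg) => s t _ _ _.
by rewrite mul1r opprD addrACA ler_normD.
Qed.

Lemma ac_uniform a b f : ac a b f -> forall e : R, 0 < e ->
  exists2 d : R, 0 < d & forall s t, a <= s -> s <= t -> t <= b -> t - s < d ->
    `|f t - f s| < e.
Proof.
move=> acf e e0; have [d d0 h] := acf e e0; exists d => // s t as_ st tb tsd.
have := h 1%N (fun=> s) (fun=> t); rewrite !big_ord1; apply => //; split => //.
by move=> i j; rewrite !ord1 eqxx.
Qed.

(** Boundedness is what makes products of absolutely continuous functions absolutely continuous. *)
Lemma ac_bounded a b f : a <= b -> ac a b f ->
  exists M : R, forall t, a <= t -> t <= b -> `|f t| <= M.
Proof.
move=> ab acf.
apply: (straddle_induction a b (fun x y => exists M : R,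
  forall t, x <= t -> t <= y -> `|f t| <= M)) => //.
  move=> x y z xy yz [M1 h1] [M2 h2]; exists (Num.max M1 M2) => t xt tz.
  rewrite le_max; have [ty|/ltW yt] := leP t y; first by rewrite h1.
  by rewrite h2 ?orbT.
move=> t /andP[at_ tb]; have [d d0 h] := ac_uniform _ _ _ acf 1 ltr01.
exists d => // s1 s2 as1 s1t ts2 s2b ds1 s2d; exists (`|f t| + 1) => s s1s ss2.
have fst_ : `|f s - f t| < 1.
  have [st|/ltW ts] := leP s t.
    by rewrite distrC; apply: h => //; lra.
  by apply: h => //; lra.
by rewrite -[f s](subrK (f t)) addrC (le_trans (ler_normD _ _))// lerD2l ltW.
Qed.

Lemma acM a b f g : a <= b -> ac a b f -> ac a b g -> ac a b (fun t => f t * g t).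
Proof.
move=> ab acf acg.
have [M hM] := ac_bounded _ _ _ ab acf; have [N hN] := ac_bounded _ _ _ ab acg.
apply: (ac_dominated _ _ _ _ _ (Num.max M N) acf acg) => s t as_ st tb.
have -> : f t * g t - f s * g s = (f t - f s) * g t + f s * (g t - g s) by ring.
rewrite (le_trans (ler_normD _ _))// !normrM mulrDr lerD//.
  by rewrite mulrC ler_wpM2r// le_max hN ?orbT// (le_trans as_).
by rewrite ler_wpM2r// le_max hM// (le_trans st).
Qed.

Lemma ac_sum a b (I : finType) (F : I -> R -> R) : (forall i, ac a b (F i)) ->
  ac a b (fun t => \sum_i F i t).
Proof.
move=> acF; elim: (index_enum I) => [|i s IH].
  apply: (ac_dominated _ _ _ _ _ 0 (ac_cst a b 0) (ac_cst a b 0)) => s t _ _ _.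
  by rewrite !big_nil subrr normr0 mul0r.
apply: (ac_dominated _ _ _ _ _ 1 (acF i) IH) => u t _ _ _.
by rewrite !big_cons mul1r opprD addrACA ler_normD.
Qed.

Lemma ac_sub a b c d f : a <= c -> d <= b -> ac a b f -> ac c d f.
Proof.
move=> ac_ db acf e e0; have [de de0 h] := acf e e0; exists de => // k u v [uv dj].
apply: h; split => // i; have [cu [uvi vd]] := uv i.
by split; [exact: le_trans cu|split => //; exact: le_trans db].
Qed.

Lemma sum_length_le_measure (U : set R) (k : nat) (a b : R) (u v : 'I_k -> R) :
  measurable U -> interval_family a b k u v ->
  (forall i t, u i <= t -> t <= v i -> U t) ->
  ((\sum_i (v i - u i))%:E <= lebesgue_measure U)%E.
Proof.
move=> mU [uv dj] sU.
(* Open intervals make segments that touch at an endpoint disjoint, at no loss of length. *)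
pose F (i : 'I_k) : set R := `]u i, v i[%classic.
have mF i : measurable (F i) by exact: measurable_itv.
have tF : trivIset [set: 'I_k] F.
  move=> i j _ _ [t [/=]]; rewrite /F /= !in_itv/= => /andP[uit tvi] /andP[ujt tvj].
  apply/eqP; apply/negP => /negP /dj[h|h].
    by have := lt_trans (lt_le_trans tvi h) ujt; rewrite ltxx.
  by have := lt_trans (lt_le_trans tvj h) uit; rewrite ltxx.
have -> : (\sum_i (v i - u i))%:E = lebesgue_measure (\big[setU/set0]_i F i).
  rewrite measure_semi_additive_ord//; last first.
    by apply: bigsetU_measurable => i _; exact: mF.
  rewrite -sumEFin; apply: eq_bigr => i _.
  rewrite [RHS](lebesgue_measure_itv `]u i, v i[) /= lte_fin; case: ltP => // vu.
  have [_ [uvi _]] := uv i.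
  have -> : u i = v i by apply/eqP; rewrite eq_le vu uvi.
  by rewrite subrr.
apply: le_measure; rewrite ?inE//; first by apply: bigsetU_measurable => i _; exact: mF.
elim/big_ind: _ => [|A B AU BU|i _] t //.
  by case => [/AU|/BU].
by rewrite /F /= in_itv/= => /andP[/ltW ut /ltW tv]; exact: sU ut tv.
Qed.

Lemma interval_family_cat a b c (k1 k2 : nat) (u1 v1 : 'I_k1 -> R)
    (u2 v2 : 'I_k2 -> R) :
  a <= b -> b <= c -> interval_family a b k1 u1 v1 ->
  interval_family b c k2 u2 v2 ->
  interval_family a c (k1 + k2)
    (fun i => match fintype.split i with inl j => u1 j | inr j => u2 j end)
    (fun i => match fintype.split i with inl j => v1 j | inr j => v2 j end).
Proof.
move=> ab bc [h1 d1] [h2 d2]; split => [i|i j].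
  case: split_ordP => k _; first by have [? [? ?]] := h1 k; split => //; lra.
  by have [? [? ?]] := h2 k; split => //; lra.
case: split_ordP => k ->; case: split_ordP => l ->.
- by move=> kl; apply: d1; apply: contraNneq kl => ->.
- by move=> _; left; have [_ [_ ?]] := h1 k; have [? _] := h2 l; lra.
- by move=> _; right; have [_ [_ ?]] := h1 l; have [? _] := h2 k; lra.
- by move=> kl; apply: d2; apply: contraNneq kl => ->.
Qed.

Lemma is_derive_upper f (t l e : R) : is_derive t 1 f l -> l < e ->
  exists2 r : R, 0 < r &
    forall s, `|s - t| < r -> s != t -> (f s - f t) / (s - t) < e.
Proof.
move=> [dft <-] le.
have : (fun h : R => h^-1 *: ((f \o shift t) (h *: 1) - f t)) @ 0^' --> 'D_1 f t.
  exact: dft.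
move=> /cvgrPdist_lt /(_ (e - 'D_1 f t)); rewrite subr_gt0 => /(_ le).
rewrite near_withinE => /nbhs_ballP[r /= r0 h].
exists r => // s sr st; have := h (s - t).
rewrite /ball /= sub0r normrN => /(_ sr); rewrite subr_eq0 => /(_ st).
rewrite /= scaler1/= subrK distrC => /ltr_normlW.
by rewrite /GRing.scale /= mulrC ltrD2r.
Qed.

Lemma ac_nonincreasing a b f : a <= b -> ac a b f ->
  {ae @lebesgue_measure R, forall t, a < t -> t < b ->
     exists2 l, l <= 0 & is_derive t 1 f l} ->
  f b <= f a.
Proof.
move=> ab acf aef; apply/ler_addgt0Pr => e0 e00.
(* Slope [e] over [[a, b]] plus variation [e] inside [U] adds up to [e0]. *)
pose e := e0 / (b - a + 1).
have ba1 : 0 < b - a + 1 by rewrite ltr_wpDl// subr_ge0.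
have ep : 0 < e by rewrite divr_gt0.
have [d d0 hd] := acf e ep.
(* The endpoints join the exceptional set because the derivative is only assumed at interior
   points. *)
have [N [mN N0 sN]] : (@lebesgue_measure R).-negligible
    (~` [set t | a < t -> t < b -> exists2 l, l <= 0 & is_derive t 1 f l]
     `|` ([set a] `|` [set b])).
  apply: negligibleU => //; apply: negligibleU; apply/negligibleP => //;
    exact: lebesgue_measure_set1.
have Nfin : (lebesgue_measure N < +oo)%E by rewrite N0 ltry.
have [U [oU NU mUN]] := lebesgue_regularity_outer mN Nfin d0.
have mU : measurable U by exact: measurable_realfun.open_measurable.
have Ud : (lebesgue_measure U < d%:E)%E.
  apply: le_lt_trans mUN; rewrite -[U in leLHS](setDUK NU).
  have : (lebesgue_measure (N `|` U `\` N) <=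
      lebesgue_measure N + lebesgue_measure (U `\` N))%E.
    by apply: measureU2 => //; exact: measurableD.
  by rewrite N0 add0e.
(* The chained relation carries a finite family inside [U] that absorbs the growth not covered by
   slope [e]. Near a point of [U] the whole interval enters the family; elsewhere the derivative
   suffices and the family is empty. *)
have : exists (k : nat) (u v : 'I_k -> R), [/\ interval_family a b k u v,
    forall i t, u i <= t -> t <= v i -> U t &
    f b - f a <= e * (b - a) + \sum_i `|f (v i) - f (u i)|].
  apply: (straddle_induction a b (fun x y =>
    exists (k : nat) (u v : 'I_k -> R), [/\ interval_family x y k u v,
    forall i t, u i <= t -> t <= v i -> U t &
    f y - f x <= e * (y - x) + \sum_i `|f (v i) - f (u i)|])) => //.
    move=> x y z xy yz [k1 [u1 [v1 [F1 U1 f1]]]] [k2 [u2 [v2 [F2 U2 f2]]]].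
    exists (k1 + k2)%N; eexists; eexists; split.
    - exact: interval_family_cat F1 F2.
    - by move=> i t /=; case: split_ordP => j _; [exact: U1|exact: U2].
    - rewrite big_split_ord /=.
      under eq_bigr do rewrite (unsplitK (inl _)).
      under [X in _ + (_ + X)]eq_bigr do rewrite (unsplitK (inr _)).
      lra.
  move=> t /andP[at_ tb].
  have [Ut|nUt] := pselect (U t).
    have /nbhs_ballP[r /= r0 rU] : nbhs t U by exact: open_nbhs_nbhs.
    exists r => // s1 s2 as1 s1t ts2 s2b rs1 s2r.
    exists 1%N, (fun=> s1), (fun=> s2); split.
    - split; first by move=> _; split => //; split => //; exact: le_trans ts2.
      by move=> i j; rewrite !ord1 eqxx.
    - move=> _ x s1x xs2; apply: rU; rewrite /ball /= ltr_norml; lra.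
    - rewrite big_ord1 (le_trans (ler_norm _))// lerDr mulr_ge0 ?(ltW ep)//.
      by rewrite subr_ge0; lra.
  have [ta tb' [l l0 dl]] : [/\ t != a, t != b & exists2 l, l <= 0 & is_derive t 1 f l].
    have nN : ~ N t by move=> /NU.
    have ta : t != a by apply/eqP => tae; apply: nN; apply: sN; right; left.
    have tb' : t != b by apply/eqP => tae; apply: nN; apply: sN; right; right.
    split => //; apply: contrapT => nex; apply: nN; apply: sN; left => /= h.
    by apply: nex; apply: h; rewrite lt_neqAle ?at_ ?tb ?andbT// eq_sym.
  have [r r0 h] := is_derive_upper f t l e dl (le_lt_trans l0 ep).
  exists r => // s1 s2 as1 s1t ts2 s2b rs1 s2r.
  exists 0%N, (fun=> 0), (fun=> 0); split; [by split => -[]|by case|].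
  rewrite big_ord0 addr0.
  have h2 : f s2 - f t <= e * (s2 - t).
    have [->|s2t] := eqVneq s2 t; first by rewrite !subrr mulr0.
    have p : 0 < s2 - t by rewrite subr_gt0 lt_neqAle eq_sym s2t.
    rewrite -ler_pdivrMr//; apply: ltW; apply: h => //.
    by rewrite gtr0_norm//; lra.
  have h1 : f t - f s1 <= e * (t - s1).
    have [->|s1t'] := eqVneq s1 t; first by rewrite !subrr mulr0.
    have p : 0 < t - s1 by rewrite subr_gt0 lt_neqAle s1t'.
    rewrite -ler_pdivrMr// -opprB -[t - s1]opprB invrN mulrNN.
    by apply: ltW; apply: h => //; rewrite distrC gtr0_norm//; lra.
  by lra.
move=> [k [u [v [fam sU le]]]].
have len : \sum_i (v i - u i) < d.
  by rewrite -lte_fin; apply: le_lt_trans Ud; exact: sum_length_le_measure fam sU.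
have := hd k u v fam len.
have : e0 = e * (b - a + 1) by rewrite /e divfK ?gt_eqF.
lra.
Qed.

End AbsoluteContinuity.

(** * Derivatives of coordinates, inner products and the projection function *)

Section Derivatives.
Context {R : realType}.

Lemma is_derive_coord n (x : R -> 'cV[R]_n) (t : R) (X : 'cV[R]_n) (i : 'I_n) :
  is_derive t 1 x X -> is_derive t 1 (fun s => x s i 0) (X i 0).
Proof.
move=> [dx <-].
have c : (fun h : R => h^-1 *: ((x \o shift t) (h *: 1) - x t)) @ 0^' --> 'D_1 x t.
  exact: dx.
have h' : (fun h : R => h^-1 *: (((fun s => x s i 0) \o shift t) (h *: 1)
    - x t i 0)) @ 0^' --> ('D_1 x t) i 0.
  have := cvg_comp _ _ c (@coord_continuous _ _ _ i 0 ('D_1 x t)).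
  by apply: cvg_trans; apply: near_eq_cvg; near=> s; rewrite /= !mxE.
split; first by apply/cvg_ex; exists (('D_1 x t) i 0).
exact: cvg_lim h'.
Unshelve. all: by end_near. Qed.

Lemma is_derive_sumf (I : finType) (F : I -> R -> R) (t : R) (dF : I -> R) :
  (forall i, is_derive t 1 (F i) (dF i)) ->
  is_derive t 1 (fun s => \sum_i F i s) (\sum_i dF i).
Proof.
move=> h; elim: (index_enum I) => [|i s IH].
  rewrite big_nil; have -> : (fun s => \sum_(i <- [::]) F i s) = cst 0.
    by apply/funext => s; rewrite big_nil.
  exact: is_derive_cst.
have -> : (fun u => \sum_(j <- i :: s) F j u) =
    F i + (fun u => \sum_(j <- s) F j u).
  by apply/funext => u; rewrite big_cons.
by rewrite big_cons; apply: is_deriveD.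
Qed.

Lemma is_derive_mulf (f g : R -> R) (t df dg : R) :
  is_derive t 1 f df -> is_derive t 1 g dg ->
  is_derive t 1 (fun s => f s * g s) (f t * dg + g t * df).
Proof. by move=> h1 h2; apply: is_deriveM. Qed.

Lemma is_derive_addf (f g : R -> R) (t df dg : R) :
  is_derive t 1 f df -> is_derive t 1 g dg ->
  is_derive t 1 (fun s => f s + g s) (df + dg).
Proof. by move=> h1 h2; apply: is_deriveD. Qed.

Definition col_derive n (u : R -> 'cV[R]_n) (t : R) (du : 'cV[R]_n) : Prop :=
  forall i, is_derive t 1 (fun s => u s i 0) (du i 0).

Lemma col_derive_mulmx n (A : 'M[R]_n) (u : R -> 'cV[R]_n) (t : R) du :
  col_derive n u t du -> col_derive n (fun s => A *m u s) t (A *m du).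
Proof.
move=> h i; rewrite mxE.
have -> : (fun s => (A *m u s) i 0) = (fun s => \sum_j A i j * u s j 0).
  by apply/funext => s; rewrite mxE.
apply: is_derive_sumf => j.
have := is_derive_mulf _ _ t _ _ (is_derive_cst (A i j) t 1) (h j).
by rewrite /cst mulr0 addr0.
Qed.

Lemma is_derive_dot n (u v : R -> 'cV[R]_n) (t : R) du dv :
  col_derive n u t du -> col_derive n v t dv ->
  is_derive t 1 (fun s => dot (u s) (v s)) (dot (u t) dv + dot du (v t)).
Proof.
move=> hu hv.
have -> : (fun s => dot (u s) (v s)) = (fun s => \sum_j u s j 0 * v s j 0).
  by apply/funext => s; rewrite dotE.
have -> : dot (u t) dv + dot du (v t) =
    \sum_j (u t j 0 * dv j 0 + v t j 0 * du j 0).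
  by rewrite big_split !dotE; congr (_ + _); apply: eq_bigr => j _; rewrite mulrC.
by apply: is_derive_sumf => j; apply: is_derive_mulf.
Qed.

Lemma ac_dot n (a b : R) (u v : R -> 'cV[R]_n) : a <= b ->
  (forall i, ac a b (fun t => u t i 0)) -> (forall i, ac a b (fun t => v t i 0)) ->
  ac a b (fun t => dot (u t) (v t)).
Proof.
move=> ab hu hv.
have -> : (fun s => dot (u s) (v s)) = (fun s => \sum_j u s j 0 * v s j 0).
  by apply/funext => s; rewrite dotE.
by apply: ac_sum => j; apply: acM.
Qed.

Lemma ac_mulmx n (a b : R) (A : 'M[R]_n) (u : R -> 'cV[R]_n) : a <= b ->
  (forall i, ac a b (fun t => u t i 0)) ->
  forall i, ac a b (fun t => (A *m u t) i 0).
Proof.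
move=> ab hu i.
have -> : (fun s => (A *m u s) i 0) = (fun s => \sum_j A i j * u s j 0).
  by apply/funext => s; rewrite mxE.
by apply: ac_sum => j; apply: acM => //; exact: ac_cst.
Qed.

Lemma abs_continuous_coord n (a b : R) (x : R -> 'cV[R]_n) i :
  abs_continuous a b x -> ac a b (fun t => x t i 0).
Proof.
move=> acx; apply: (abs_continuous_ac _ _ _ _ _ 1 acx) => s t _ _ _.
rewrite mul1r; have := coord_le_enorm (x t - x s) i.
by rewrite !mxE.
Qed.

Lemma ac_derivable (a b C : R) (f df : R -> R) :
  (forall t, a <= t -> t <= b -> is_derive t 1 f (df t)) ->
  (forall t, a <= t -> t <= b -> `|df t| <= C) -> ac a b f.
Proof.
move=> dfE dfC; apply: (ac_lipschitz _ _ _ C) => s t as_ st tb.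
have [||c] := @MVT_segment _ f df s t st.
- move=> x; rewrite in_itv/= => /andP[/ltW sx /ltW xt].
  by apply: dfE; [exact: le_trans sx|exact: le_trans tb].
- apply: derivable_within_continuous => x; rewrite in_itv/= => /andP[sx xt].
  by have [] := dfE x (le_trans as_ sx) (le_trans xt tb).
rewrite in_itv/= => /andP[sc ct] ->; rewrite normrM (ger0_norm (_ : 0 <= t - s)).
  by rewrite ler_wpM2r ?subr_ge0// dfC// ?(le_trans as_)// (le_trans ct).
by rewrite subr_ge0.
Qed.

Lemma is_derive_expRM (mu t : R) :
  is_derive t 1 (fun s => expR (mu * s)) (mu * expR (mu * t)).
Proof.
have -> : (fun s => expR (mu * s)) = expR \o (fun s => mu * s) by [].
have d : is_derive t 1 (fun s => mu * s) mu.
  have := is_derive_mulf _ _ t _ _ (is_derive_cst mu t 1) (is_derive_id t 1).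
  by rewrite /cst mulr0 addr0 mulr1.
rewrite mulrC; exact: is_derive1_comp.
Qed.

Lemma ac_expR (a b mu : R) : 0 <= mu -> ac a b (fun t => expR (mu * t)).
Proof.
move=> mu0; apply: (ac_derivable _ _ (mu * expR (mu * b)) _
  (fun t => mu * expR (mu * t))) => t at_ tb; first exact: is_derive_expRM.
rewrite normrM !ger0_norm ?expR_ge0//.
by rewrite ler_wpM2l// ler_expR ler_wpM2l.
Qed.

(** The difference quotient along a basis vector is exactly affine in [h], so its limit can be read
    off. *)
Lemma grad_projf n (vartheta eps : R) (theta : 'cV[R]_n) :
  grad (projf vartheta eps) theta =
  (2 / (2 * eps * vartheta + eps ^+ 2)) *: theta.
Proof.
apply/colP => i; rewrite !mxE; set c := 2 * eps * vartheta + eps ^+ 2.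
apply: cvg_lim => //.
apply: (@cvg_trans _ ((fun h : R => 2 / c * theta i 0 + h / c) @ 0^')).
  apply: near_eq_cvg; near=> h => /=.
  have hn0 : h != 0 by near: h; exact: nbhs_dnbhs_neq.
  rewrite /projf -/c !enorm_sqr !dotDl !dotDr !dotZl !dotZr.
  have -> : dot (delta_mx i 0) theta = theta i 0.
    rewrite dotE (bigD1 i)//= mxE !eqxx mul1r big1 ?addr0// => j ji.
    by rewrite mxE (negbTE ji) mul0r.
  have -> : dot theta (delta_mx i 0) = theta i 0.
    rewrite dotE (bigD1 i)//= mxE !eqxx mulr1 big1 ?addr0// => j ji.
    by rewrite mxE (negbTE ji) mulr0.
  have -> : dot (delta_mx i 0) (delta_mx i 0) = 1 :> R.
    rewrite dotE (bigD1 i)//= mxE !eqxx mulr1 big1 ?addr0// => j ji.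
    by rewrite mxE (negbTE ji) mulr0.
  set ci := c^-1; rewrite /GRing.scale /=.
  by field.
have h0 : (fun h : R => h) @ 0^' --> (0 : R) by apply: cvg_within_filter; exact: cvg_id.
have h1 : (fun h : R => h / c) @ 0^' --> (0 / c : R).
  exact: (cvgM h0 (cvg_cst c^-1)).
by have := cvgD (cvg_cst (2 / c * theta i 0)) h1; rewrite mul0r addr0; exact.
Unshelve. all: by end_near. Qed.

End Derivatives.

(** * Combining almost everywhere statements *)

Section AlmostEverywhere.
Context {R : realType}.
Implicit Types P Q : R -> Prop.

Lemma lebesgue_aeS P Q : (forall t, P t -> Q t) ->
  {ae @lebesgue_measure R, forall t, P t} ->
  {ae @lebesgue_measure R, forall t, Q t}.
Proof.
move=> PQ [N [mN N0 sN]]; exists N; split => // t nQ.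
by apply: sN => /PQ.
Qed.

Lemma lebesgue_aeI P Q : {ae @lebesgue_measure R, forall t, P t} ->
  {ae @lebesgue_measure R, forall t, Q t} ->
  {ae @lebesgue_measure R, forall t, P t /\ Q t}.
Proof.
move=> aeP aeQ; apply: negligibleS (negligibleU aeP aeQ) => t /= nPQ.
have [Pt|nPt] := pselect (P t); last by left.
by right => Qt; apply: nPQ.
Qed.

End AlmostEverywhere.

(** * Invariance of a sublevel set *)

Section Barrier.
Context {R : realType}.

(* Only the times after the last visit to the sublevel set matter, and there w
   is nonincreasing. *)
Lemma ac_barrier (T M : R) (w : R -> R) : 0 <= T -> ac 0 T w -> w 0 <= M ->
  {ae @lebesgue_measure R, forall t, 0 < t -> M < w t ->
     exists2 l, l <= 0 & is_derive t 1 w l} ->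
  w T <= M.
Proof.
move=> T0 acw w0 aew; rewrite leNgt; apply/negP => wT.
pose S := [set s | 0 <= s <= T /\ w s <= M].
have S0 : S 0 by split => //; rewrite lexx.
have hS : has_sup S by split; [exists 0|exists T => s [/andP[]]].
pose s := sup S.
have s0 : 0 <= s by apply: ub_le_sup S0; exact: hS.2.
have sT : s <= T by apply: ge_sup => [|u [/andP[_]]]; [exists 0|].
(* By continuity the last visit is attained, so [w] exceeds [M] only strictly after [s]. *)
have ws : w s <= M.
  rewrite leNgt; apply/negP => Mws.
  have wM : 0 < w s - M by rewrite subr_gt0.
  have [d d0 hd] := ac_uniform _ _ _ acw _ wM.
  have [u [/andP[u0 uT] wu] us] := sup_adherent d0 hS.
  have us' : u <= s by apply: ub_le_sup; [exact: hS.2|split => //; rewrite u0].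
  have : `|w s - w u| < w s - M by apply: hd => //; rewrite -/s in us; lra.
  by move=> /ltr_normlW; lra.
have : w T <= w s.
  apply: (ac_nonincreasing s T) => //.
    exact: (ac_sub 0 T).
  apply: lebesgue_aeS aew => t ht st tT; apply: ht; first exact: le_lt_trans st.
  rewrite ltNge; apply/negP => wt.
  have : S t by split => //; rewrite (ltW tT) andbT (le_trans s0 (ltW st)).
  by move=> /(ub_le_sup hS.2); rewrite leNgt st.
by lra.
Qed.

End Barrier.

(** * The projection operator *)

Section Projection.
Context {R : realType} {n : nat}.
Variables (vartheta eps gamma : R).
Hypotheses (vp : 0 < vartheta) (ep : 0 < eps) (gp : 0 < gamma).
Let f : 'cV[R]_n -> R := projf vartheta eps.
Implicit Types theta y w : 'cV[R]_n.

Let c := 2 * eps * vartheta + eps ^+ 2.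
Let c0 : 0 < c.
Proof. by rewrite addr_gt0 ?mulr_gt0 ?exprn_gt0. Qed.

(** The gradient is a positive multiple of [theta] and the gain is scalar, so the multiple cancels:
    when active, the projection removes the fraction [f theta] of the radial part of
    [gamma *: y]. *)
Lemma ProjE theta y : Proj gamma%:M theta y f =
  gamma *: y - (if (0 < f theta) && (0 < dot theta y) then
    (f theta * (gamma * dot theta y / dot theta theta)) *: theta else 0).
Proof.
rewrite /Proj grad_projf -/c !mul_scalar_mx !dotZr !dotZl.
set k := 2 / c; have k0 : 0 < k by rewrite divr_gt0.
rewrite (dotC y) (pmulr_rgt0 _ gp) (pmulr_rgt0 _ k0).
case: ifP => [/andP[_ ty0]|_]; last by rewrite subr0.
have tn0 : dot theta theta != 0.
  rewrite dot_eq0; apply/eqP => t0; move: ty0.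
  by rewrite t0 dotC dot0r ltxx.
congr (_ - _); rewrite -scalerA; congr (_ *: _).
have -> : (k *: theta)^T = k *: theta^T by apply/rowP => i; rewrite !mxE.
rewrite mul_mx_scalar -!scalemxAl -!scalemxAr -!scalemxAl -mulmxA dot_outer.
rewrite !scalerA; congr (_ *: _).
by field; rewrite tn0 (gt_eqF k0) (gt_eqF gp).
Qed.

Lemma dot_Proj_le theta y w : (0 < f theta -> 0 <= dot w theta) ->
  dot w (Proj gamma%:M theta y f) <= gamma * dot w y.
Proof.
move=> h; rewrite ProjE dotDr dotNr dotZr; case: ifP => [/andP[f0 ty0]|_].
  rewrite dotZr lerBlDr lerDl mulr_ge0 ?h// mulr_ge0 ?(ltW f0)//.
  by rewrite divr_ge0 ?dot_ge0// mulr_ge0 ?(ltW gp) ?(ltW ty0).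
by rewrite dot0r subr0.
Qed.

(** [f] reaches 1 exactly on the sphere of radius [vartheta + eps]. From there on an outward radial
    part is multiplied by [1 - f theta <= 0], and an inward one is left alone. *)
Lemma dot_Proj_self theta y : (vartheta + eps) ^+ 2 <= dot theta theta ->
  dot theta (Proj gamma%:M theta y f) <= 0.
Proof.
move=> ht; have f1 : 1 <= f theta.
  rewrite /f /projf enorm_sqr -/c ler_pdivlMr// mul1r /c.
  by move: ht; rewrite sqrrD; lra.
have f0 : 0 < f theta := lt_le_trans ltr01 f1.
rewrite ProjE dotDr dotNr dotZr f0 /=; case: ifP => [ty0|].
  have tn0 : 0 < dot theta theta.
    by apply: lt_le_trans ht; rewrite exprn_gt0// addr_gt0.
  rewrite dotZr.
  have -> : gamma * dot theta y
      - f theta * (gamma * dot theta y / dot theta theta) * dot theta theta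
    = (1 - f theta) * (gamma * dot theta y) by field; rewrite gt_eqF.
  by rewrite mulr_le0_ge0 ?subr_le0// mulr_ge0 ?(ltW gp) ?(ltW ty0).
by move=> /negbT; rewrite -leNgt dot0r subr0 => ty; rewrite mulr_ge0_le0// ltW.
Qed.

Lemma dot_deviation_ge0 (theta_star theta : 'cV[R]_n) :
  enorm theta_star <= vartheta -> 0 < f theta ->
  0 <= dot (theta - theta_star) theta.
Proof.
move=> hs; rewrite /f /projf -/c pmulr_lgt0 ?invr_gt0// subr_gt0 => ht.
have vt : vartheta <= enorm theta.
  by apply: sqr_le_sqrt; [exact: enorm_ge0|exact: ltW].
rewrite dotDl dotNl -enorm_sqr subr_ge0 (le_trans (cauchy_schwarz _ _))//.
by rewrite expr2 ler_wpM2r ?enorm_ge0// (le_trans hs).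
Qed.

Lemma Proj_invariant (theta y : R -> 'cV[R]_n) :
  solves theta (fun t => Proj gamma%:M (theta t) (y t) f) ->
  enorm (theta 0) <= vartheta + eps ->
  forall t, 0 <= t -> enorm (theta t) <= vartheta + eps.
Proof.
move=> [act det] h0 t t0.
have ve0 : 0 <= vartheta + eps by rewrite ltW// addr_gt0.
apply: sqr_le_sqrt => //; rewrite enorm_sqr.
apply: (ac_barrier t ((vartheta + eps) ^+ 2) (fun t => dot (theta t) (theta t))) => //.
- by apply: ac_dot => // i; apply: abs_continuous_coord; exact: act.
- by rewrite -enorm_sqr lerXn2r// nnegrE enorm_ge0.
apply: lebesgue_aeS det => s hs s0 lts; have ds := hs s0.
have hc : col_derive n theta s (Proj gamma%:M (theta s) (y s) f).
  by move=> i; exact: is_derive_coord.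
have h := is_derive_dot _ _ _ _ _ _ hc hc.
eexists; last exact: h.
have := dot_Proj_self _ (y s) (ltW lts).
by rewrite (dotC (Proj _ _ _ _)); lra.
Qed.

End Projection.

(** * Integral bound from a dissipation inequality *)

Section Energy.
Context {R : realType}.

(** Freezing [h] at [h 0] on the negative axis gives continuity on the whole line, as wanted for
    measurability and the fundamental theorem of calculus. *)
Lemma ac_clip_continuous (h : R -> R) : (forall T, 0 <= T -> ac 0 T h) ->
  continuous (fun t : R => h (Num.max 0 t)).
Proof.
move=> ach t; apply/cvgrPdist_lt => e e0.
have T0 : 0 <= `|t| + 1 by rewrite addr_ge0.
have [d d0 hd] := ac_uniform _ _ _ (ach _ T0) e e0.
have lip (s1 s2 : R) : s1 <= s2 -> s1 <= `|t| + 1 -> s2 <= `|t| + 1 ->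
    s2 - s1 < d -> `|h (Num.max 0 s2) - h (Num.max 0 s1)| < e.
  move=> s12 s1t s2t sd; apply: hd.
  - by rewrite le_max lexx.
  - by rewrite ge_max le_max lexx /= le_max s12 orbT.
  - by rewrite ge_max T0 s2t.
  - case: (leP 0 s1) => s10; first by rewrite max_r// (le_trans s10).
    by rewrite subr0 gt_max d0 /=; lra.
have tt : t <= `|t| + 1 by rewrite (le_trans (ler_norm t))// lerDl.
apply/nbhs_ballP; exists (Num.min d 1); first by rewrite /= lt_min d0 /=.
move=> s /=; rewrite /ball /= lt_min => /andP[sd sl].
have /andP[d1 d2] : - d < t - s < d by rewrite -ltr_norml.
have /andP[l1 l2] : - 1 < t - s < 1 by rewrite -ltr_norml.
have st : s <= `|t| + 1 by have := ler_norm t; lra.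
have [ts|/ltW ts] := leP t s; first by rewrite distrC; apply: lip => //; lra.
by apply: lip => //; lra.
Qed.

Lemma ac_energy (V h : R -> R) : (forall T, 0 <= T -> ac 0 T V) ->
  (forall T, 0 <= T -> ac 0 T h) ->
  (forall t, 0 <= V t) -> (forall t, 0 <= h t) ->
  {ae @lebesgue_measure R, forall t, 0 < t ->
     exists2 l, l <= - h t & is_derive t 1 V l} ->
  (\int[@lebesgue_measure R]_(t in `[0%R, +oo[) (h t)%:E <= (V 0)%:E)%E.
Proof.
move=> acV ach V0 h0 aeV.
pose g (t : R) : R := h (Num.max 0 t).
have cg : continuous g := ac_clip_continuous _ ach.
have g0 (t : R) : 0 <= g t by exact: h0.
have gE (t : R) : 0 <= t -> g t = h t by move=> t0; rewrite /g max_r.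
have ig (a b : R) : (@lebesgue_measure R).-integrable `[a, b] (EFin \o g).
  apply: continuous_compact_integrable; first exact: segment_compact.
  exact: continuous_subspaceT.
(* Starting at -1 makes 0 an interior point, so [F] has a two-sided derivative there too. *)
pose F (u : R) := \int[@lebesgue_measure R]_(t in `[- 1, u]) g t.
have dF (t : R) : 0 <= t -> is_derive t 1 F (g t).
  move=> t0; have t1 : t < t + 1 by rewrite ltrDl.
  have t2 : - 1 < t by lra.
  have [dF F'] := continuous_FTC1_closed t1 (ig (- 1) (t + 1)) t2 (cg t).
  by apply: DeriveDef; rewrite -?derive1E.
have acF (T : R) : 0 <= T -> ac 0 T F.
  move=> T0; have [M hM] := ac_bounded _ _ _ T0 (ach T T0).
  apply: (ac_derivable 0 T M F g) => t t0 tT; first exact: dF.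
  by rewrite gE// hM.
have FV (T : R) : 0 <= T -> F T - F 0 <= V 0.
  move=> T0; suff : V T + F T <= V 0 + F 0 by have := V0 T; lra.
  apply: (ac_nonincreasing 0 T (fun t => V t + F t)) => //.
    by apply: acD; [exact: acV|exact: acF].
  apply: lebesgue_aeS aeV => t ht t0 _; have [l le dV] := ht t0.
  have := is_derive_addf _ _ _ _ _ dV (dF t (ltW t0)).
  by apply: ex_intro2; rewrite (gE t (ltW t0)); lra.
have intn (k : nat) :
    (\int[@lebesgue_measure R]_(t in `[0%R, k%:R]) (g t)%:E <= (V 0)%:E)%E.
  have := FV k%:R (ler0n _ _); rewrite /F (Rintegral_itvB (ig (- 1) k%:R)); last 2 first.
  - by rewrite bnd_simp; lra.
  - by rewrite bnd_simp.
  rewrite -lee_fin /Rintegral fineK; last first.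
    apply: integrable_fin_num => //.
    apply: integrableS (ig 0 k%:R) => //.
    by apply: subset_itvr; rewrite bnd_simp.
  rewrite integral_itv_obnd_cbnd//.
  apply: measurable_funS measurableT _ _ => //.
  apply/measurable_realfun.measurable_EFinP.
  exact: measurable_realfun.continuous_measurable_fun.
have mg : measurable_fun setT g.
  exact: measurable_realfun.continuous_measurable_fun.
have -> : (\int[@lebesgue_measure R]_(t in `[0%R, +oo[) (h t)%:E =
    \int[@lebesgue_measure R]_(t in `[0%R, +oo[) (g t)%:E)%E.
  by apply: eq_integral => t; rewrite inE/= in_itv/= andbT => t0; rewrite gE.
have cvi := @ge0_cvgn_integral R (@lebesgue_measure R) g g0 mg.
by apply: (cvge_le _ cvi); apply: nearW.
Qed.

End Energy.

(** * Error dynamics and the Lyapunov function of the closed loop *)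

Section Trajectory.
Context {R : realType} {n : nat}.
Variables (A_p A_m P : 'M[R]_n) (b theta_star : 'cV[R]_n) (r : R -> R).
Variables (vartheta eps ell gamma : R) (x x_m theta : R -> 'cV[R]_n).
Let f : 'cV[R]_n -> R := projf vartheta eps.
Let e t := x t - x_m t.
Let w t := theta t - theta_star.
Hypotheses (n0 : (0 < n)%N) (hA : Hurwitz A_m) (ell0 : 0 <= ell).
Hypotheses (gp : 0 < gamma) (vp : 0 < vartheta) (ep : 0 < eps).
Hypotheses (matching : A_m = A_p + b *m theta_star^T)
  (star_le : enorm theta_star <= vartheta).
Hypotheses (pP : sym_posdef P)
  (eqP : (A_m - ell%:M)^T *m P + P *m (A_m - ell%:M) = - 1%:M).
Hypotheses
  (sx : solves x (fun t => A_p *m x t + (dot (theta t) (x t) + r t) *: b))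
  (sxm : solves x_m
     (fun t => A_m *m x_m t + r t *: b + ell *: (x t - x_m t)))
  (st : solves theta
     (fun t => Proj gamma%:M (theta t) (- (x t *m (e t)^T *m P *m b)) f)).
Hypothesis theta0 : enorm (theta 0) <= vartheta + eps.

(** Matching trades [A_p] for [A_m] and the reference input cancels, so the parameter error is the
    only remaining input. *)
Lemma error_field t :
  A_p *m x t + (dot (theta t) (x t) + r t) *: b
  - (A_m *m x_m t + r t *: b + ell *: (x t - x_m t))
  = (A_m - ell%:M) *m e t + dot (w t) (x t) *: b.
Proof.
have -> : A_p = A_m - b *m theta_star^T by rewrite matching addrK.
rewrite !mulmxBl -mulmxA dot_outer mul_scalar_mx /e /w mulmxBr dotDl dotNl.
by apply/colP => i; rewrite !mxE; ring.
Qed.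

Let V t := dot (e t) (P *m e t) + gamma^-1 * dot (w t) (w t).

(** The adaptation law is designed for this cancellation: its unprojected part contributes
    [- 2 <P e, b> <w, x>], the opposite of the cross term of the error dynamics. *)
Lemma lyapunov_rate t :
  2 * dot (P *m e t) ((A_m - ell%:M) *m e t + dot (w t) (x t) *: b)
  + gamma^-1 * (2 * dot (w t)
      (Proj gamma%:M (theta t) (- (x t *m (e t)^T *m P *m b)) f))
  <= - dot (e t) (e t).
Proof.
have -> : x t *m (e t)^T *m P *m b = dot (P *m e t) b *: x t.
  by rewrite -!mulmxA dot_outer dot_mulmx pP.1.
rewrite dotDr dotZr mulrDr (lyapunov_form A_m P ell pP eqP) -addrA gerDl.
have := @dot_Proj_le _ n vartheta eps gamma vp ep gp (theta t)
  (- (dot (P *m e t) b *: x t)) (w t)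
  (@dot_deviation_ge0 _ n vartheta eps vp ep theta_star (theta t) star_le).
rewrite dotNr dotZr -/f => h.
have gi : 0 < gamma^-1 by rewrite invr_gt0.
have := ler_wpM2l (ltW gi) h; rewrite [leRHS]mulKf ?gt_eqF//.
by rewrite [X in _ -> _ + X <= 0]mulrCA; set q := gamma^-1 * _; lra.
Qed.

Lemma coord_e_ac T i : 0 <= T -> ac 0 T (fun t => e t i 0).
Proof.
move=> T0; have -> : (fun t => e t i 0) =
    (fun t => x t i 0 + (fun=> -1) t * x_m t i 0).
  by apply/funext => t; rewrite !mxE mulN1r.
apply: acD; first by apply: abs_continuous_coord; exact: sx.1.
apply: acM => //; first exact: ac_cst.
by apply: abs_continuous_coord; exact: sxm.1.
Qed.

Lemma coord_w_ac T i : 0 <= T -> ac 0 T (fun t => w t i 0).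
Proof.
move=> T0; have -> : (fun t => w t i 0) =
    (fun t => theta t i 0 + (fun=> - theta_star i 0) t).
  by apply/funext => t; rewrite !mxE.
apply: acD; first by apply: abs_continuous_coord; exact: st.1.
exact: ac_cst.
Qed.

Lemma V_ac T : 0 <= T -> ac 0 T V.
Proof.
move=> T0; apply: acD.
  apply: ac_dot => // i; first exact: coord_e_ac.
  by apply: ac_mulmx => // j; exact: coord_e_ac.
apply: acM => //; first exact: ac_cst.
by apply: ac_dot => // i; exact: coord_w_ac.
Qed.

Lemma V_derive : {ae @lebesgue_measure R, forall t, 0 < t ->
  exists2 l, l <= - dot (e t) (e t) & is_derive t 1 V l}.
Proof.
have := lebesgue_aeI _ _ sx.2 (lebesgue_aeI _ _ sxm.2 st.2).
apply: lebesgue_aeS => t [hx [hm ht]] t0.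
have de : col_derive n e t ((A_m - ell%:M) *m e t + dot (w t) (x t) *: b).
  rewrite -error_field => i; apply: is_derive_coord.
  by apply: is_deriveB; [exact: hx|exact: hm].
have dw : col_derive n w t
    (Proj gamma%:M (theta t) (- (x t *m (e t)^T *m P *m b)) f).
  move=> i; apply: is_derive_coord.
  have := is_deriveB (ht t0) (is_derive_cst theta_star t 1).
  by rewrite subr0.
have := is_derive_addf _ _ _ _ _
  (is_derive_dot _ _ _ _ _ _ de (col_derive_mulmx _ P _ _ _ de))
  (is_derive_mulf _ _ _ _ _ (is_derive_cst gamma^-1 t 1)
    (is_derive_dot _ _ _ _ _ _ dw dw)).
apply: ex_intro2; apply: le_trans (lyapunov_rate t).
set de' := _ + _ *: b; set dw' := Proj _ _ _ _.
rewrite (dotC dw') dot_mulmx pP.1 (dotC de') /cst mulr0 addr0; lra.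
Qed.

Let sg := sigma_of A_m.
Let a := opnorm A_m.
Let m := (1 + 4 * a / sg) ^+ n.-1.
Let sg0 : 0 < sg := sigma_of_gt0 A_m n0 hA.
Let a0 : 0 <= a := opnorm_ge0 A_m.
Let sl0 : 0 < sg + 2 * ell.
Proof. by rewrite ltr_pwDl// mulr_ge0. Qed.
Let m0 : 0 < m.
Proof. by rewrite exprn_gt0// ltr_pwDl// divr_ge0 ?mulr_ge0// ltW. Qed.
Let mu := (sg + 2 * ell) / m ^+ 2.
Let mu0 : 0 < mu.
Proof. by rewrite divr_gt0// exprn_gt0. Qed.
Let K := gamma^-1 * (2 * vartheta + eps) ^+ 2.

Let w_le t : 0 <= t -> gamma^-1 * dot (w t) (w t) <= K.
Proof.
move=> t0; rewrite ler_wpM2l ?invr_ge0 ?(ltW gp)// -enorm_sqr.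
rewrite lerXn2r ?nnegrE ?enorm_ge0 ?addr_ge0 ?mulr_ge0 ?(ltW vp) ?(ltW ep)//.
rewrite (le_trans (enormD _ _))// enormN.
have := Proj_invariant _ _ _ vp ep gp theta _ st theta0 t t0.
have := star_le; lra.
Qed.

Let w_ge0 t : 0 <= gamma^-1 * dot (w t) (w t).
Proof. by rewrite mulr_ge0 ?dot_ge0// invr_ge0 ltW. Qed.

Let lyap_le v : dot v (P *m v) <= mu^-1 * dot v v.
Proof.
rewrite /mu invf_div.
exact: (lyapunov_le A_m P ell n0 hA ell0 pP eqP).
Qed.

Lemma V_decay t : 0 <= t ->
  dot (e t) (P *m e t) <= dot (e 0) (P *m e 0) * expR (- mu * t) + K.
Proof.
move=> t0.
(* [K] dominates the parameter term and [mu^-1] bounds [P], so [mu * (V - K) <= |e|^2]; with the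
   integrating factor the derivative is nonpositive. *)
have : (V t + (- K)) * expR (mu * t) <= (V 0 + (- K)) * expR (mu * 0).
  apply: (ac_nonincreasing 0 t (fun t => (V t + (- K)) * expR (mu * t))) => //.
    apply: acM => //; last by apply: ac_expR; exact: ltW.
    by apply: acD; [exact: V_ac|exact: ac_cst].
  apply: lebesgue_aeS V_derive => s hs s0 _; have [l le dV] := hs s0.
  have dexp : is_derive s 1 (fun s => expR (mu * s)) (mu * expR (mu * s)).
    exact: is_derive_expRM.
  have := is_derive_mulf _ _ _ _ _
    (is_derive_addf _ _ _ _ _ dV (is_derive_cst (- K) s 1)) dexp.
  apply: ex_intro2.
  have -> : (V s + cst (- K) s) * (mu * expR (mu * s)) + expR (mu * s) * (l + 0)
    = expR (mu * s) * (mu * (V s - K) + l) by rewrite /cst; ring.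
  rewrite mulr_ge0_le0 ?expR_ge0//.
  have h1 : mu * dot (e s) (P *m e s) <= dot (e s) (e s).
    by rewrite mulrC -ler_pdivlMr// mulrC lyap_le.
  have h2 : mu * (gamma^-1 * dot (w s) (w s)) <= mu * K.
    by rewrite ler_wpM2l ?(ltW mu0)// w_le// ltW.
  by rewrite /V; lra.
rewrite mulr0 expR0 mulr1 -ler_pdivlMr ?expR_gt0// -expRN => h.
rewrite [X in expR X]mulNr.
(* Subtracting [K] also removes the initial parameter error from the decaying term. *)
have h1 : V 0 - K <= dot (e 0) (P *m e 0).
  by rewrite /V; have := w_le 0 (lexx 0); lra.
have := ler_wpM2r (expR_ge0 (- (mu * t))) h1.
have : dot (e t) (P *m e t) <= V t by rewrite /V lerDl.
by move: h; lra.
Qed.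

Lemma error_bound t : 0 <= t ->
  enorm (e t) ^+ 2 <=
    4 * m ^+ 4 * (1 + a / sg) ^+ 2 * enorm (e 0) ^+ 2 *
      expR (- ((sg + 2 * ell) / m ^+ 2) * t)
    + 4 * m ^+ 2 * (1 + a / sg) ^+ 2 / (gamma / (sg + ell))
      * (2 * vartheta + eps) ^+ 2.
Proof.
move=> t0; rewrite !enorm_sqr -/mu.
(* The reciprocal of the lower bound on [P]. Then [L / mu] yields [kappa1], because
   [(a + ell) / (sg + 2 * ell) <= 1 + a / sg] for every [ell >= 0]. *)
pose L := 4 * (a + ell) ^+ 2 * (m ^+ 2 / (sg + 2 * ell)).
have L0 : 0 <= L.
  have sl1 : 0 <= (sg + 2 * ell)^-1 by rewrite invr_ge0 ltW.
  rewrite /L; apply: mulr_ge0; first by apply: mulr_ge0; rewrite ?sqr_ge0.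
  by apply: mulr_ge0; rewrite ?sqr_ge0.
apply: (le_trans (lyapunov_ge A_m P ell n0 hA ell0 pP eqP (e t))).
apply: (le_trans (ler_wpM2l L0 (V_decay t t0))); rewrite mulrDr lerD//.
  rewrite mulrA ler_wpM2r ?expR_ge0//.
  apply: (le_trans (ler_wpM2l L0 (lyap_le (e 0)))).
  rewrite mulrA ler_wpM2r ?dot_ge0// /L /mu invf_div.
  have -> : 4 * (a + ell) ^+ 2 * (m ^+ 2 / (sg + 2 * ell)) *
      (m ^+ 2 / (sg + 2 * ell)) =
    4 * m ^+ 4 * ((a + ell) / (sg + 2 * ell)) ^+ 2.
    by field; rewrite gt_eqF.
  have m4 : 0 <= m ^+ 4 by rewrite exprn_ge0// ltW.
  rewrite ler_wpM2l//; first by rewrite mulr_ge0.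
  have q0 : 0 <= a / sg by rewrite divr_ge0// ltW.
  apply: lerXn2r; rewrite ?nnegrE ?addr_ge0//.
    by apply: divr_ge0; [exact: addr_ge0|exact: ltW].
  rewrite ler_pdivrMr//.
  have : a / sg * sg = a by rewrite divfK ?gt_eqF.
  by have := mulr_ge0 q0 ell0; have := ell0; have := sg0; set q := a / sg; lra.
rewrite /K mulrA ler_wpM2r ?sqr_ge0//.
rewrite invf_div mulrA ler_wpM2r ?invr_ge0 ?(ltW gp)// /L.
have -> : 4 * (a + ell) ^+ 2 * (m ^+ 2 / (sg + 2 * ell)) =
  4 * m ^+ 2 * ((a + ell) ^+ 2 / (sg + 2 * ell)) by field; rewrite gt_eqF.
rewrite -[leRHS]mulrA; rewrite ler_wpM2l//; first by rewrite mulr_ge0 ?sqr_ge0.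
rewrite ler_pdivrMr//.
(* After squaring, one factor [sg + ell] cancels against [sg + 2 * ell] and the other becomes the
   numerator of [1 / rho]. *)
have al : a + ell <= (1 + a / sg) * (sg + ell).
  have : a / sg * sg = a by rewrite divfK ?gt_eqF.
  have : 0 <= a / sg by rewrite divr_ge0// ltW.
  move=> q0; have := mulr_ge0 q0 ell0; have := ell0; have := sg0.
  by set q := a / sg; lra.
apply: (@le_trans _ _ (((1 + a / sg) * (sg + ell)) ^+ 2)).
  by rewrite lerXn2r// nnegrE ?addr_ge0// (le_trans _ al)// addr_ge0.
rewrite exprMn -[leRHS]mulrA ler_wpM2l ?sqr_ge0// expr2.
by rewrite ler_wpM2l ?addr_ge0 ?(ltW sg0)// lerD2l; have := ell0; lra.
Qed.

Lemma V_ge0 t : 0 <= V t.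
Proof. by rewrite addr_ge0 ?w_ge0// (sym_posdef_ge0 P pP). Qed.

(** The total dissipation is at most [V 0]. Its [P] part is weakened from [1 / (sg + 2 * ell)] to
    [1 / (sg + ell)], and [1 / gamma] is [1 / rho] divided by [sg + ell]. *)
Lemma error_energy :
  (\int[@lebesgue_measure R]_(t in `[0%R, +oo[) (enorm (e t) ^+ 2)%:E <=
     (1 / (sg + ell) * (m ^+ 2 * enorm (e 0) ^+ 2
        + 1 / (gamma / (sg + ell)) * enorm (theta 0 - theta_star) ^+ 2))%:E)%E.
Proof.
have sl1 : 0 < sg + ell by rewrite ltr_pwDl.
apply: (@le_trans _ _ (V 0)%:E).
  apply: ac_energy; [exact: V_ac| |exact: V_ge0|by move=> t; rewrite sqr_ge0|].
    move=> T T0; have -> : (fun t => enorm (e t) ^+ 2) = (fun t => dot (e t) (e t)).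
      by apply/funext => t; rewrite enorm_sqr.
    by apply: ac_dot => // i; exact: coord_e_ac.
  by apply: lebesgue_aeS V_derive => t h /h; rewrite enorm_sqr.
rewrite lee_fin /V !enorm_sqr -/(w 0) mulrDr lerD//.
  apply: (le_trans (lyap_le (e 0))); rewrite /mu invf_div mulrA.
  rewrite ler_wpM2r ?dot_ge0// mulrC mul1r.
  rewrite ler_wpM2r ?sqr_ge0// lef_pV2 ?posrE//.
  by have := ell0; lra.
have -> : 1 / (sg + ell) * (1 / (gamma / (sg + ell)) * dot (w 0) (w 0)) =
  gamma^-1 * dot (w 0) (w 0); last by [].
by field; rewrite !gt_eqF.
Qed.

End Trajectory.

Theorem theorem7 (R : realType) (n : nat) (A_p A_m : 'M[R]_n)
    (b theta_star : 'cV[R]_n) (r : R -> R) (theta_star_max eps : R) :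
  (0 < n)%N ->
  Hurwitz A_m ->
  A_m = A_p + b *m theta_star^T ->
  0 < theta_star_max ->
  enorm theta_star <= theta_star_max ->
  0 < eps ->
  (exists M : R, forall t : R, 0 <= t -> `|r t| <= M) ->
  let sigma := sigma_of A_m in
  let a := opnorm A_m in
  let m := (1 + 4 * a / sigma) ^+ n.-1 in
  let f := projf theta_star_max eps in
  let theta_max := theta_star_max + eps in
  let theta_tilde_max := 2 * theta_star_max + eps in
  exists kappa1 kappa2 : R, 0 < kappa1 /\ 0 < kappa2 /\
  forall (ell gamma : R) (P : 'M[R]_n) (x x_m theta : R -> 'cV[R]_n),
    let Abar_m := A_m - ell%:M in
    let u := fun t : R => dot (theta t) (x t) + r t in
    let e := fun t : R => x t - x_m t in
    let rho := gamma / (sigma + ell) in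
    0 <= ell ->
    0 < gamma ->
    sym_posdef P ->
    Abar_m^T *m P + P *m Abar_m = - 1%:M ->
    solves x (fun t => A_p *m x t + u t *: b) ->
    solves x_m (fun t => A_m *m x_m t + r t *: b + ell *: (x t - x_m t)) ->
    solves theta
      (fun t => Proj gamma%:M (theta t) (- (x t *m (e t)^T *m P *m b)) f) ->
    enorm (theta 0) <= theta_max ->
    (forall t : R, 0 <= t ->
       enorm (e t) ^+ 2 <=
         kappa1 * enorm (e 0) ^+ 2 * expR (- ((sigma + 2 * ell) / m ^+ 2) * t)
         + kappa2 / rho * theta_tilde_max ^+ 2) /\
    (\int[@lebesgue_measure R]_(t in `[0%R, +oo[) (enorm (e t) ^+ 2)%:E <=
       (1 / (sigma + ell) *
         (m ^+ 2 * enorm (e 0) ^+ 2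
          + 1 / rho * enorm (theta 0 - theta_star) ^+ 2))%:E)%E.
Proof.
move=> n0 hA matching vp star_le ep _ sigma a m f theta_max theta_tilde_max.
have sg0 : 0 < sigma := sigma_of_gt0 A_m n0 hA.
have a0 : 0 <= a := opnorm_ge0 A_m.
have m0 : 0 < m.
  by rewrite exprn_gt0// ltr_pwDl// divr_ge0 ?mulr_ge0// ltW.
have q0 : 0 < 1 + a / sigma by rewrite ltr_pwDl// divr_ge0// ltW.
(* The witnesses depend on [A_m] and [n] alone, hence can be fixed before [ell], [gamma] and [P]. *)
exists (4 * m ^+ 4 * (1 + a / sigma) ^+ 2), (4 * m ^+ 2 * (1 + a / sigma) ^+ 2).
split; first by rewrite mulr_gt0 ?(exprn_gt0 2 q0)// mulr_gt0 ?(exprn_gt0 4 m0).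
split; first by rewrite mulr_gt0 ?(exprn_gt0 2 q0)// mulr_gt0 ?(exprn_gt0 2 m0).
move=> ell gamma P x x_m theta Abar_m u e rho ell0 gp pP eqP sx sxm st theta0.
split.
  move=> t t0.
  exact: (error_bound A_p A_m P b theta_star r theta_star_max eps ell gamma
    x x_m theta).
exact: (error_energy A_p A_m P b theta_star r theta_star_max eps ell gamma
  x x_m theta).
Qed.
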